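(* There is an absolute constant $C>0$ such that the following holds. Let $n\ge 2$ and let $\{Z(t_i)\}_{1\le i\le n}$ be jointly multivariate normal random variables with $\mathbb{E}Z(t_i)=0$, $\mathbb{E}Z(t_i)^2=1$ for all $i$, and, writing $r_{j,k}:=\mathbb{E}Z(t_j)Z(t_k)$, with $|r_{j,k}|<1$ whenever $j\ne k$. Suppose further that the sequence is stationary, that is, $r_{j,k}=r(|j-k|)$ for some function $r$. Let $u\ge 1$, and suppose that: (a) $r(m)$ is a decreasing nonnegative function; (b) $r(1)(1+2u^{-2})\le 1$. Then there exist real numbers $\theta_1,\dots,\theta_{n-1}$ with $|\theta_j|\le \dfrac{C}{u^2(1-r(j))}$ for each $j$, such that $$\mathbb{P}\Bigl(\max_{1\le i\le n}Z(t_i)>u\Bigr)\ \ge\ n\,\frac{e^{-u^2/2}}{40\,u}\,\min\Biggl\{1,\sqrt{\frac{1-r(1)}{u^2r(1)}}\Biggr\}\ \prod_{j=1}^{n-1}\Phi\Bigl(u\sqrt{1-r(j)}\,(1+\theta_j)\Bigr).$$ (In particular $C$ does not depend on $n$, $u$ or $\{Z(t_i)\}_{1\le i\le n}$.)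
   Context: $\Phi$ denotes the standard normal cumulative distribution function. If $r(1)=0$ the minimum is interpreted as $1$. *)

(* Defs.v *)
(* MathComp-Analysis *)
From HB Require Import structures.
From mathcomp Require Import all_boot all_order all_algebra.
From mathcomp Require Import all_classical all_reals all_analysis.

Set Implicit Arguments.
Unset Strict Implicit.
Unset Printing Implicit Defensive.

Import Order.TTheory GRing.Theory Num.Theory.
Import numFieldNormedType.Exports.

Local Open Scope classical_set_scope.
Local Open Scope ring_scope.

(* [normal_prob m 0] is by convention the uniform law on [0, 1], whereas
   N(m, 0), which arises from degenerate linear combinations, must be the
   point mass at [m]. *)
Definition normal_law (R : realType) (m s : R) (A : set R) : \bar R :=
  if s == 0 then \d_m A else normal_prob m s A.

Definition normally_distributed (d : measure_display) (T : measurableType d)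
    (R : realType) (P : probability T R) (X : T -> R) : Prop :=
  exists m s : R, forall A : set R, measurable A ->
    P (X @^-1` A) = normal_law m s A.

(* Every linear combination is normal, possibly degenerate, so the covariance
   matrix is allowed to be singular. *)
Definition jointly_normal (d : measure_display) (T : measurableType d)
    (R : realType) (P : probability T R) (n : nat)
    (Z : 'I_n -> {RV P >-> R}) : Prop :=
  forall a : 'I_n -> R,
    normally_distributed P (fun w => \sum_(i < n) a i * Z i w).

Definition std_normal_cdf (R : realType) (x : R) : R :=
  fine (normal_prob 0 1 `]-oo, x]).

(* Main.v *)
(* Fix an index m and write a_j = r(m - j). The first-passage decomposition
   P(max Z > u) = sum_m P(Z_m > u, Z_j <= u for j < m) reduces the theorem to a
   lower bound for each summand. As r is decreasing and nonnegative,
   Cov(Z_i, Z_j) >= min(a_i, a_j) for distinct i, j < m, so Slepian's inequality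
   compares Z with Y_m = X, Y_j = a_j X + B(a_j) + sqrt(1 - a_j) eta_j, where X is
   standard normal, B a Brownian bridge and the eta_j independent standard
   normals. When X exceeds u by O(1/u) and the bridge stays below 1/u, Y_j <= u as
   soon as sqrt(1 - a_j) eta_j <= u (1 - a_j) - 2/u, which produces the factors
   Phi(u sqrt(1 - a_j) (1 + theta_j)) with theta_j = -2/(u^2 (1 - a_j)); the
   bridge condition costs the factor min{1, sqrt((1 - r(1))/(u^2 r(1)))}, by the
   reflection inequality for Gaussian walks.

   Gaussian vectors are handled only through E cos(a.X + b) = cos(b) exp(-Var(a.X)/2).
   For products of one-variable trigonometric sums this gives the derivative of
   the expectation along the interpolation between two covariances in closed
   form, hence Slepian's inequality for smooth functions; indicators follow by
   approximating them with periodic sawtooth functions obtained from the Poisson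
   kernel, whose positive slopes are negligible. *)
Require Import Defs.
From HB Require Import structures.
From mathcomp Require Import all_boot all_order all_algebra.
From mathcomp Require Import all_classical all_reals all_analysis.
From mathcomp Require Import measurable_realfun ring lra.
From mathcomp Require complex.

Set Implicit Arguments.
Unset Strict Implicit.
Unset Printing Implicit Defensive.

Import Order.TTheory GRing.Theory Num.Theory.
Import numFieldNormedType.Exports.

Local Open Scope classical_set_scope.
Local Open Scope ring_scope.

(** Covariance matrices may be singular, so no joint density is available; cosine expectations avoid
    the need for one. Slepian's inequality is used for a mixed event, one coordinate above its level
    and the others below. This is legitimate because Cov(Y_m, Y_j) = a_j = Cov(Z_m, Z_j) exactly, so
    the interpolation changes only covariances between coordinates that must stay below.

    The bridge is (1 - a) W(a / (1 - a)) with W a Brownian motion, sampled at finitely many times as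
    a Gaussian walk. Keeping it below (1 - a)/u means keeping W below 1/u up to time r(1)/(1 -
    r(1)). By reflection this has probability at least P(|N| <= rho), N standard normal and rho^2 =
    (1 - r(1))/(u^2 r(1)), which is the origin of the minimum.

    The constant 40 collects a window of length 3/(8u) for X, an interval of length 2 min(1, rho)
    for N, and the bounds 1/(2 pi) >= 1/8 and exp(-9/8) >= 4/15 for the density values. *)

(** * Product measures and integrals of bounded functions *)

Section product_probability.
Context d1 d2 (T1 : measurableType d1) (T2 : measurableType d2) (R : realType).
Variables (P : probability T1 R) (Q : probability T2 R).

(** Naming the product measure lets it carry a canonical probability structure. *)
Definition prodP : set (T1 * T2) -> \bar R := (P \x Q)%E.

HB.instance Definition _ := Measure.on prodP.

Lemma prodP_setT : prodP setT = 1%E.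
Proof.
rewrite /prodP -setXTT [LHS]product_measure1E// -[RHS]mule1.
by congr (_ * _)%E; exact: probability_setT.
Qed.

HB.instance Definition _ := Measure_isProbability.Build _ _ _ prodP prodP_setT.

Lemma prodP_setX A B : measurable A -> measurable B ->
  prodP (A `*` B) = (P A * Q B)%E.
Proof. by move=> mA mB; rewrite /prodP product_measure1E. Qed.

End product_probability.

Section bounded_integrals.
Context d (T : measurableType d) (R : realType) (P : probability T R).
Implicit Types f g : T -> R.

Lemma bounded_integrable f M : measurable_fun setT f ->
  (forall x, `|f x| <= M) -> P.-integrable setT (EFin \o f).
Proof.
move=> mf fM; apply: measurable_bounded_integrable => //.
  by apply: (@le_lt_trans _ _ 1%E); [exact: probability_le1|exact: ltry].
exists M; split; first exact: num_real.
by move=> x Mx y _ /=; apply: le_trans (fM y) (ltW Mx).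
Qed.

Lemma Rintegral_indic A : measurable A -> \int[P]_x \1_A x = fine (P A).
Proof. by move=> mA; rewrite /Rintegral integral_indic// setIT. Qed.

End bounded_integrals.

Lemma prodP_Rintegral d1 d2 (T1 : measurableType d1) (T2 : measurableType d2)
    (R : realType) (P : probability T1 R) (Q : probability T2 R)
    (f : T1 * T2 -> R) M : measurable_fun setT f -> (forall x, `|f x| <= M) ->
  \int[prodP P Q]_z f z = \int[P]_x \int[Q]_y f (x, y).
Proof.
move=> mf fM.
have intf : (P \x Q)%E.-integrable setT (EFin \o f).
  exact: (bounded_integrable (prodP P Q) mf fM).
rewrite /Rintegral -[in LHS](integral12_prod_meas1 intf).
congr fine; apply: eq_integral => x _; rewrite fineK//.
apply: integrable_fin_num => //.
apply: (@bounded_integrable _ _ _ Q (fun y => f (x, y)) M); last by move=> y; exact: fM.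
exact: measurableT_comp.
Qed.

(** * One-dimensional normal integrals: integration by parts, moments, cosine transform *)

Section integral_of_derivative.
Context (R : realType).
Notation mu := (@lebesgue_measure R).

(** The integral over [-N, N] is G(N) - G(-N), which tends to 0 by the decay hypothesis;
    integrability of g lets N tend to infinity. *)
Lemma Rintegral_derive_vanishing (G g : R -> R) (a C : R) :
  (forall x : R, is_derive x 1 G (g x)) -> continuous g ->
  mu.-integrable setT (EFin \o g) ->
  (forall x, `|G x| * `|x - a| <= C) ->
  \int[mu]_x g x = 0.
Proof.
move=> dG cg ig GC.
pose g_ n x := (g x * \1_(`[- n.+1%:R, n.+1%:R] : set R) x).
have mg : measurable_fun setT g by exact: continuous_measurable_fun.
have cvg1 : (\int[mu]_x (g_ n x)%:E)%E @[n --> \oo] --> (\int[mu]_x (g x)%:E)%E.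
  have [] := @dominated_convergence _ _ R mu _ measurableT
    (fun n x => (g_ n x)%:E) (fun x => (g x)%:E) (fun x => (`|g x|)%:E) => //.
  - move=> n; apply/measurable_EFinP; apply: measurable_funM => //.
  - by apply/measurable_EFinP.
  - apply/aeW => x _; apply: cvg_EFin; first by apply: nearW.
    apply: cvg_near_cst; near=> n => /=.
    rewrite /g_ indicE mem_set ?mulr1//= in_itv/= -ler_norml.
    apply: (@le_trans _ _ n%:R); last by rewrite ler_nat.
    near: n; exact: nbhs_infty_ger.
  - exact: integrable_norm ig.
  - apply/aeW => x n _; rewrite lee_fin normrM ler_piMr//.
    by rewrite indicE; case: (_ \in _); rewrite ?normr1 ?normr0.
have gE n : (\int[mu]_x (g_ n x)%:E)%E = (G n.+1%:R - G (- n.+1%:R))%:E.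
  rewrite EFinB -(@continuous_FTC2 _ g G (- n.+1%:R) n.+1%:R).
  - rewrite [in RHS]integral_mkcond; apply: eq_integral => x _.
    by rewrite restrict_EFin/= /g_ patchE indicE; case: ifPn; rewrite ?mulr1 ?mulr0.
  - by rewrite (@lt_trans _ _ 0)// ?oppr_lt0 ltr0n.
  - exact: continuous_subspaceT.
  - have cG : continuous G.
      by move=> x; apply: differentiable_continuous; apply/derivable1_diffP.
    split; first by move=> x _; case: (dG x).
      exact/cvg_at_right_filter/cG.
    exact/cvg_at_left_filter/cG.
  - by move=> x _; rewrite derive1E; case: (dG x).
have cvg2 : (\int[mu]_x (g_ n x)%:E)%E @[n --> \oo] --> 0%E.
  under eq_fun do rewrite gE.
  apply: cvg_EFin; first exact: nearW.
  have lim0 (h : nat -> R) : (forall n, n.+1%:R <= `|h n - a| + `|a|) ->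
      G (h n) @[n --> \oo] --> 0.
    move=> hn; have C0 : 0 <= C.
      by apply: le_trans (GC 0); rewrite mulr_ge0.
    apply/cvgr0Pnorm_le => e e0; near=> n.
    have hpos : 0 < C / e + 1 by rewrite ltr_wpDl// divr_ge0// ltW.
    have ha : C / e + 1 <= `|h n - a|.
      rewrite -(lerD2r `|a|) (le_trans _ (hn n))//.
      rewrite (@le_trans _ _ n%:R) ?ler_nat//.
      near: n; exact: nbhs_infty_ger.
    have := GC (h n); rewrite -ler_pdivlMr ?(lt_le_trans hpos)// => /le_trans; apply.
    rewrite ler_pdivrMr ?(lt_le_trans hpos)// (@le_trans _ _ (e * (C / e + 1)))//.
      rewrite mulrDr mulr1 mulrCA divff ?mulr1 ?gt_eqF//.
      by rewrite lerDl ltW.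
    by rewrite ler_pM2l.
  rewrite -(subr0 (0 : R)); apply: (@cvgB _ R^o); apply: lim0 => n.
    by rewrite -[leLHS]ger0_norm// -[X in `|X| <= _](subrK a) ler_normD.
  by rewrite -[leLHS]ger0_norm// -normrN -[X in `|X| <= _](subrK a) ler_normD.
by rewrite /Rintegral (cvg_unique _ cvg1 cvg2).
Unshelve. all: by end_near. Qed.

End integral_of_derivative.

Section normal_density_moments.
Context (R : realType).
Notation mu := (@lebesgue_measure R).
Variables (m s : R).
Hypothesis s0 : s != 0.
Notation pdf := (normal_pdf m s).

Let s2_gt0 : 0 < s ^+ 2. Proof. by rewrite exprn_even_gt0. Qed.

Lemma is_derive_normal_pdf (x : R) :
  is_derive x 1 pdf (- ((x - m) / s ^+ 2) * pdf x).
Proof.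
rewrite normal_pdfE//= /normal_fun.
have -> : (fun x => normal_peak s * expR (- (x - m) ^+ 2 / (s ^+ 2 *+ 2))) =
    (fun x => normal_peak s *: expR (- (s ^+ 2 *+ 2)^-1 *: (x - m) ^+ 2)).
  apply/funext => y; rewrite /GRing.scale/=; congr (_ * expR _).
  by rewrite mulNr mulrC mulNr.
apply: is_derive_eq.
rewrite /GRing.scale/=.
have -> : - (x - m) ^+ 2 / (s ^+ 2 *+ 2) = - (s ^+ 2 *+ 2)^-1 * (x - m) ^+ 2 by ring.
by field.
Qed.

(** Doubling the variance halves the exponent, and the half set free absorbs the quadratic factor
    through 1 + z <= exp z. Integrability and boundedness with a quadratic weight then come from
    those of a normal density. *)
Lemma normal_pdf_sqr_le : exists C : R, forall x,
  (1 + (x - m) ^+ 2) * pdf x <= C * normal_pdf m (Num.sqrt 2 * s) x.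
Proof.
have s20 : Num.sqrt 2 * s != 0 by rewrite mulf_neq0// gt_eqF// sqrtr_gt0.
exists ((1 + 4 * s ^+ 2) * normal_peak s / normal_peak (Num.sqrt 2 * s)) => x.
rewrite !normal_pdfE//= -mulrA.
rewrite (mulrA _^-1) mulVf ?gt_eqF ?normal_peak_gt0// mul1r.
rewrite mulrCA [leRHS]mulrAC [leRHS]mulrC ler_wpM2l ?normal_peak_ge0//.
rewrite /normal_fun exprMn sqr_sqrtr//.
set y := (x - m) ^+ 2.
have y0 : 0 <= y by exact: sqr_ge0.
set z := y / (4 * s ^+ 2).
have -> : - y / (s ^+ 2 *+ 2) = - z + - z by rewrite /z; field.
have -> : - y / (2 * s ^+ 2 *+ 2) = - z by rewrite /z; field.
rewrite expRD mulrA ler_wpM2r ?expR_ge0//.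
rewrite expRN ler_pdivrMr ?expR_gt0//.
have z0 : 0 <= z by rewrite divr_ge0// mulr_ge0// ltW.
apply: (@le_trans _ _ ((1 + 4 * s ^+ 2) * (1 + z))); last first.
  by rewrite ler_wpM2l ?expR_ge1Dx// addr_ge0// mulr_ge0// ltW.
have -> : y = 4 * s ^+ 2 * z by rewrite /z; field.
have := mulr_ge0 (ltW s2_gt0) z0; nra.
Qed.

Lemma integrable_sqr_normal_pdf :
  mu.-integrable setT (fun x => ((1 + (x - m) ^+ 2) * pdf x)%:E).
Proof.
have [C CP] := normal_pdf_sqr_le.
apply: (@le_integrable _ _ _ mu _ measurableT _
  (fun x => (C%:E * (normal_pdf m (Num.sqrt 2 * s) x)%:E)%E)).
- apply/measurable_EFinP; apply: measurable_funM; last exact: measurable_normal_pdf.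
  by apply: measurable_funD => //; apply: measurable_funX; apply: measurable_funB.
- move=> x _; rewrite -EFinM lee_fin ger0_norm.
    exact: le_trans (CP x) (ler_norm _).
  by rewrite mulr_ge0 ?normal_pdf_ge0// addr_ge0// sqr_ge0.
- apply: integrableZl => //; exact: integrable_normal_pdf.
Qed.

Lemma normal_pdf_sqr_bounded : exists C : R, forall x,
  (1 + (x - m) ^+ 2) * pdf x <= C.
Proof.
have [C CP] := normal_pdf_sqr_le.
have s20 : Num.sqrt 2 * s != 0 by rewrite mulf_neq0// gt_eqF// sqrtr_gt0.
exists (`|C| * normal_peak (Num.sqrt 2 * s)) => x; apply: le_trans (CP x) _.
apply: (@le_trans _ _ (`|C| * normal_pdf m (Num.sqrt 2 * s) x)).
  by rewrite ler_wpM2r ?normal_pdf_ge0// ler_norm.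
by rewrite ler_wpM2l// normal_pdf_ub.
Qed.

(** Stein's identity: the derivative of h times the density is h' pdf - ((x - m) / s^2) h pdf, and
    its integral vanishes. Linear growth of h is allowed so that h(x) = x - m yields the
    variance. *)
Lemma normal_pdf_stein (h h' : R -> R) (C : R) :
  (forall x : R, is_derive x 1 h (h' x)) -> continuous h' ->
  (forall x, `|h x| <= C * (1 + `|x - m|)) -> (forall x, `|h' x| <= C) ->
  \int[mu]_x ((x - m) * h x * pdf x) = s ^+ 2 * \int[mu]_x (h' x * pdf x).
Proof.
move=> dh ch' hC h'C.
have C0 : 0 <= C by apply: le_trans (h'C 0).
have ch : continuous h.
  by move=> x; apply: differentiable_continuous; apply/derivable1_diffP; case: (dh x).
have mh := continuous_measurable_fun ch.
have mh' := continuous_measurable_fun ch'.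
have mxm : measurable_fun setT (fun x : R => x - m) by exact: measurable_funB.
have mpdf := measurable_normal_pdf m s.
have y1 (y : R) : (1 + `|y|) * `|y| <= 2 * (1 + y ^+ 2).
  rewrite -[y ^+ 2]real_normK ?num_real//; have := normr_ge0 y; nra.
have i1 : mu.-integrable setT (fun x => ((x - m) * h x * pdf x)%:E).
  apply: (@le_integrable _ _ _ mu _ measurableT _
    (fun x => ((2 * C)%:E * ((1 + (x - m) ^+ 2) * pdf x)%:E)%E)).
  - by apply/measurable_EFinP; do !apply: measurable_funM.
  - move=> x _; rewrite -EFinM lee_fin [leRHS]ger0_norm; last first.
      by rewrite !mulr_ge0 ?normal_pdf_ge0// addr_ge0// sqr_ge0.
    rewrite !normrM (ger0_norm (normal_pdf_ge0 _ _ _)).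
    rewrite mulrA ler_wpM2r ?normal_pdf_ge0//.
    have := y1 (x - m); have := hC x; have := normr_ge0 (x - m).
    move=> A B D; apply: (@le_trans _ _ (`|x - m| * (C * (1 + `|x - m|)))).
      by rewrite ler_wpM2l.
    have -> : `|x - m| * (C * (1 + `|x - m|)) = C * ((1 + `|x - m|) * `|x - m|) by ring.
    by rewrite (mulrC 2) -[leRHS]mulrA ler_wpM2l.
  - by apply: integrableZl => //; exact: integrable_sqr_normal_pdf.
have i2 : mu.-integrable setT (fun x => (h' x * pdf x)%:E).
  apply: (@le_integrable _ _ _ mu _ measurableT _
    (fun x => (C%:E * (pdf x)%:E)%E)).
  - by apply/measurable_EFinP; apply: measurable_funM.
  - move=> x _; rewrite -EFinM lee_fin !normrM (ger0_norm (normal_pdf_ge0 _ _ _)).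
    by rewrite (ger0_norm C0) ler_wpM2r ?normal_pdf_ge0.
  - by apply: integrableZl => //; exact: integrable_normal_pdf.
have [D DP] := normal_pdf_sqr_bounded.
pose g x := h' x * pdf x - (s ^+ 2)^-1 * ((x - m) * h x * pdf x).
have i3 : mu.-integrable setT (fun x => ((s ^+ 2)^-1 * ((x - m) * h x * pdf x))%:E).
  by under eq_fun do rewrite EFinM; apply: integrableZl.
have : \int[mu]_x g x = 0.
  apply: (@Rintegral_derive_vanishing R (fun x => h x * pdf x) g m (2 * C * D)).
  - move=> x; have dhx := dh x; have dp := is_derive_normal_pdf x.
    apply: is_derive_eq; rewrite /g /GRing.scale/=.
    by rewrite mulNr mulrN addrC (mulrC (pdf x)); congr (_ - _); field.
  - move=> x; apply: (@cvgB _ R^o).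
      by apply: cvgM; [exact: ch'|exact: continuous_normal_pdf].
    apply: cvgM; first exact: cvg_cst.
    apply: cvgM; last exact: continuous_normal_pdf.
    apply: cvgM; last exact: ch.
    by apply: (@cvgB _ R^o); [exact: cvg_id|exact: cvg_cst].
  - rewrite /comp /g; under eq_fun do rewrite EFinB.
    by apply: integrableB.
  - move=> x; rewrite normrM (ger0_norm (normal_pdf_ge0 _ _ _)).
    apply: (@le_trans _ _ (2 * C * ((1 + (x - m) ^+ 2) * pdf x))); last first.
      by rewrite ler_wpM2l ?mulr_ge0.
    rewrite mulrAC mulrA ler_wpM2r ?normal_pdf_ge0//.
    apply: (@le_trans _ _ (C * (1 + `|x - m|) * `|x - m|)); first by rewrite ler_wpM2r.
    by rewrite -mulrA (mulrC 2) -[leRHS]mulrA ler_wpM2l.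
rewrite /g RintegralB// RintegralZl// => /eqP; rewrite subr_eq0 => /eqP ->.
by rewrite mulrA divff ?mul1r// gt_eqF.
Qed.

End normal_density_moments.

Section normal_moments.
Context (R : realType).
Notation mu := (@lebesgue_measure R).
Variables (m s : R).
Hypothesis s0 : s != 0.
Notation pdf := (normal_pdf m s).

Lemma Rintegral_normal_pdf : \int[mu]_x pdf x = 1.
Proof. by rewrite /Rintegral integral_normal_pdf. Qed.

Lemma normal_pdf_mean : \int[mu]_x ((x - m) * pdf x) = 0.
Proof.
have : \int[mu]_x ((x - m) * 1 * pdf x) = s ^+ 2 * \int[mu]_x (0 * pdf x).
  apply: (@normal_pdf_stein R m s s0 (fun=> 1) (fun=> 0) 1).
  - by move=> x; exact: cvg_cst.
  - by move=> x; rewrite mul1r normr1 lerDl.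
  - by move=> x; rewrite normr0.
under eq_Rintegral do rewrite mulr1.
move=> ->; under eq_Rintegral do rewrite mul0r.
by rewrite Rintegral_cst// mul0r mulr0.
Qed.

Lemma normal_pdf_var : \int[mu]_x ((x - m) ^+ 2 * pdf x) = s ^+ 2.
Proof.
have : \int[mu]_x ((x - m) * (x - m) * pdf x) = s ^+ 2 * \int[mu]_x (1 * pdf x).
  apply: (@normal_pdf_stein R m s s0 (fun x => x - m) (fun=> 1) 1).
  - by move=> x; apply: is_derive_eq; rewrite subr0.
  - by move=> x; exact: cvg_cst.
  - by move=> x; rewrite mul1r lerDr.
  - by move=> x; rewrite normr1.
under eq_Rintegral do rewrite -expr2.
move=> ->; under eq_Rintegral do rewrite mul1r.
by rewrite Rintegral_normal_pdf mulr1.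
Qed.

Let mcos t b : measurable_fun setT (fun x : R => cos (t * (x - m) + b)).
Proof.
apply: measurableT_comp; first by apply: continuous_measurable_fun; exact: continuous_cos.
by apply: measurable_funD => //; apply: measurable_funM => //; exact: measurable_funB.
Qed.

Let H b t := \int[mu]_x (cos (t * (x - m) + b) * pdf x).

Let integrableH b t : mu.-integrable setT (fun x => (cos (t * (x - m) + b) * pdf x)%:E).
Proof.
apply: (@le_integrable _ _ _ mu _ measurableT _ (fun x => (pdf x)%:E)).
- by apply/measurable_EFinP; apply: measurable_funM; [exact: mcos|exact: measurable_normal_pdf].
- move=> x _; rewrite lee_fin normrM ler_piMl// ler_norml.
  by rewrite cos_geN1 cos_le1.
- exact: integrable_normal_pdf.
Qed.

(** Differentiation under the integral brings down -(x - m) sin, and Stein's identity turns this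
    back into [H], giving a linear differential equation in t. *)
Let is_derive_H (b t : R) : is_derive t 1 (H b) (- (s ^+ 2 * t) * H b t).
Proof.
pose f (t0 x : R) := cos (t0 * (x - m) + b) * pdf x.
have df (t0 x : R) : is_derive t0 1 (f ^~ x) (- (x - m) * sin (t0 * (x - m) + b) * pdf x).
  rewrite /f; apply: is_derive_eq.
  by rewrite /GRing.scale/=; ring.
pose G (x : R) := (1 + (x - m) ^+ 2) * pdf x.
have tI : `](t - 1), (t + 1)[%classic t.
  by rewrite /= in_itv/= ltrBlDr ltrDl ltr01.
have G0 y : 0 <= G y by rewrite mulr_ge0 ?normal_pdf_ge0// addr_ge0// sqr_ge0.
have fI t' : `](t - 1), (t + 1)[%classic t' -> mu.-integrable setT (EFin \o f t').
  by move=> _; exact: integrableH.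
have dfI t' y : `](t - 1), (t + 1)[%classic t' -> [set: R] y -> derivable (f^~ y) t' 1.
  by move=> _ _; case: (df t' y).
have GI : mu.-integrable setT (EFin \o G) by exact: integrable_sqr_normal_pdf.
have pE (t' y : R) : partial1of2 f t' y = - (y - m) * sin (t' * (y - m) + b) * pdf y.
  by rewrite /partial1of2 derive1E; case: (df t' y).
have Gub (t' y : R) : `](t - 1), (t + 1)[%classic t' -> [set: R] y -> `|partial1of2 f t' y| <= G y.
  move=> _ _; rewrite pE normrM (ger0_norm (normal_pdf_ge0 _ _ _)) ler_wpM2r ?normal_pdf_ge0//.
  apply: (@le_trans _ _ `|y - m|).
    rewrite normrM normrN ler_piMr// ler_norml.
    by rewrite sin_geN1 sin_le1.
  rewrite -[(y - m) ^+ 2]real_normK ?num_real//; have := normr_ge0 (y - m); nra.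
apply: DeriveDef.
  exact: (@derivable_under_integral R _ _ mu f setT measurableT t _ _ tI fI dfI G G0 GI Gub).
rewrite -derive1E.
rewrite (@differentiation_under_integral R _ _ mu f setT measurableT t _ _ tI fI dfI G G0 GI Gub).
have -> : \int[mu]_y partial1of2 f t y =
    \int[mu]_y (-1 * ((y - m) * sin (t * (y - m) + b) * pdf y)).
  apply: eq_Rintegral => y _; rewrite pE; ring.
have dsin (x : R) : is_derive x 1 (fun x => sin (t * (x - m) + b)) (t * cos (t * (x - m) + b)).
  apply: is_derive_eq.
  by rewrite /GRing.scale/=; ring.
have st := @normal_pdf_stein R m s s0 _ _ (1 + `|t|) dsin.
have int1 : mu.-integrable setT (fun x => ((x - m) * sin (t * (x - m) + b) * pdf x)%:E).
  apply: (@le_integrable _ _ _ mu _ measurableT _ (EFin \o G)) => //.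
    apply/measurable_EFinP; apply: measurable_funM; last exact: measurable_normal_pdf.
    apply: measurable_funM; first exact: measurable_funB.
    apply: measurableT_comp; first by apply: continuous_measurable_fun; exact: continuous_sin.
    by apply: measurable_funD => //; apply: measurable_funM => //; exact: measurable_funB.
  move=> x _; rewrite lee_fin (ger0_norm (G0 x)); have := Gub t x tI I.
  by rewrite pE !mulNr normrN.
rewrite RintegralZl// st.
- have -> : \int[mu]_x (t * cos (t * (x - m) + b) * pdf x) = t * H b t.
    rewrite /H -RintegralZl//; last exact: integrableH.
    by apply: eq_Rintegral => x _; rewrite mulrA.
  by ring.
- move=> x; apply: cvgM; first exact: cvg_cst.
  apply: (cvg_comp (fun x => t * (x - m) + b) cos); last exact: continuous_cos.
  apply: (@cvgD _ R^o); last exact: cvg_cst.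
  apply: cvgM; first exact: cvg_cst.
  by apply: (@cvgB _ R^o); [exact: cvg_id|exact: cvg_cst].
- move=> x; apply: (@le_trans _ _ 1); first by rewrite ler_norml sin_geN1 sin_le1.
  by have := normr_ge0 t; have := normr_ge0 (x - m); nra.
- move=> x; rewrite normrM (@le_trans _ _ `|t|) ?lerDr// ler_piMr// ler_norml.
  by rewrite cos_geN1 cos_le1.
Qed.

(** The integral times exp(s^2 t^2 / 2) has zero derivative in t, so it keeps its value at t = 0. *)
Lemma normal_pdf_cos t b :
  \int[mu]_x (cos (t * (x - m) + b) * pdf x) = cos b * expR (- (t ^+ 2 * s ^+ 2 / 2)).
Proof.
pose h t := H b t * expR (s ^+ 2 / 2 * t ^+ 2).
have dh (x : R) : is_derive x (1 : R) h 0.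
  have dH := is_derive_H b x.
  rewrite /h; apply: is_derive_eq.
  by rewrite /GRing.scale/=; field.
have := is_derive_0_is_cst t 0 dh.
rewrite /h expr0n/= mulr0 expR0 mulr1.
have -> : H b 0 = cos b.
  rewrite /H; under eq_Rintegral do rewrite mul0r add0r.
  rewrite RintegralZl//; last exact: integrable_normal_pdf.
  by rewrite Rintegral_normal_pdf mulr1.
by move=> <-; rewrite -[RHS]mulrA -expRD (_ : _ + _ = 0) ?expR0 ?mulr1//; ring.
Qed.

(** The Radon-Nikodym derivative is determined only almost everywhere; it is identified with the
    density because both have the same integral over every measurable set. *)
Lemma Rintegral_normal_prob (f : R -> R) :
  (normal_prob m s).-integrable setT (EFin \o f) ->
  \int[normal_prob m s]_x f x = \int[mu]_x (f x * pdf x).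
Proof.
move=> intf; rewrite /Rintegral; congr fine.
have mf : measurable_fun setT (EFin \o f) by exact: (measurable_int _ intf).
rewrite -(Radon_Nikodym_change_of_variables (normal_prob_dominates m s))//=.
apply: ae_eq_integral => //.
- apply: emeasurable_funM => //; apply: (measurable_int mu).
  by apply: Radon_Nikodym_integrable; exact: normal_prob_dominates.
- by apply/measurable_EFinP; apply: measurable_funM;
    [exact/measurable_EFinP|exact: measurable_normal_pdf].
- under [in X in ae_eq _ _ _ X]eq_fun do rewrite EFinM.
  apply: ae_eqe_mul2l => /=.
  rewrite Radon_NikodymE//=; first exact: normal_prob_dominates.
  move=> abmu; case: cid => /= h [h1 h2 h3].
  apply: integral_ae_eq => //=.
  + by apply/measurable_EFinP; exact: measurable_normal_pdf.
  + by move=> E E01 mE; rewrite -h3.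
Qed.

End normal_moments.

(** * Gaussian vectors described by cosine expectations *)

Section centered_normal_law.
Context d (T : measurableType d) (R : realType) (P : probability T R).
Variable L : T -> R.
Hypothesis mL : measurable_fun setT L.

Let LR : {RV P >-> measurableTypeR R} :=
  HB.pack (L : T -> measurableTypeR R) (isMeasurableFun.Build _ _ T (measurableTypeR R) L mL).

Lemma Rintegral_law (nu : probability (measurableTypeR R) R) (f : R -> R) :
  (forall A : set (measurableTypeR R), measurable A -> P (L @^-1` A) = nu A) ->
  measurable_fun setT f -> P.-integrable setT (EFin \o (f \o L)) ->
  nu.-integrable setT (EFin \o f) /\ \int[P]_w f (L w) = \int[nu]_x f x.
Proof.
move=> lawL mf intf.
have eqm (A : set (measurableTypeR R)) : measurable A -> A `<=` setT -> distribution P LR A = nu A.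
  by move=> mA _; rewrite -lawL.
have mEf : measurable_fun setT (EFin \o f) by exact/measurable_EFinP.
split.
  apply/integrableP; split => //.
  rewrite -(eq_measure_integral nu eqm).
  rewrite (@ge0_integral_distribution _ _ T (measurableTypeR R) R P LR (fun y => `|(f y)%:E|%E))//.
    by move: intf => /integrableP[].
  exact: measurableT_comp.
rewrite /Rintegral -(eq_measure_integral nu eqm); congr fine.
by rewrite (@integral_distribution _ _ T (measurableTypeR R) R P LR (EFin \o f)).
Qed.

(** The moments identify the unknown parameters: mean 0 forces m = 0, and the second moment is s^2.
    In the degenerate case the law is a point mass, and the same moments give m = v = 0. *)
Lemma Rintegral_cos_normal_law (v : R) :
  normally_distributed P L ->
  P.-integrable setT (fun w => (L w)%:E) ->
  P.-integrable setT (fun w => (L w ^+ 2)%:E) ->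
  \int[P]_w L w = 0 -> \int[P]_w (L w ^+ 2) = v ->
  forall b, \int[P]_w cos (L w + b) = cos b * expR (- (v / 2)).
Proof.
move=> [m [s lawL]] iL iL2 EL EL2 b.
have mcos : measurable_fun setT (fun x : R => cos (x + b)).
  apply: measurableT_comp; first by apply: continuous_measurable_fun; exact: continuous_cos.
  by apply: measurable_funD.
have icos : P.-integrable setT (EFin \o ((fun x : R => cos (x + b)) \o L)).
  apply: (@bounded_integrable _ _ _ _ _ 1).
    exact: (measurableT_comp mcos mL).
  by move=> w /=; rewrite ler_norml cos_geN1 cos_le1.
have mid : measurable_fun setT (fun x : R => x) by exact: measurable_id.
have msq : measurable_fun setT (fun x : R => x ^+ 2) by exact: measurable_funX.
have [s0|s0] := eqVneq s 0.
  have law : forall A : set R, measurable A -> P (L @^-1` A) = \d_m A.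
    by move=> A mA; rewrite lawL// /normal_law s0 eqxx.
  have dE (f : measurableTypeR R -> R) : measurable_fun setT f ->
      \int[\d_(m : measurableTypeR R)]_x f x = f m.
    move=> mf; rewrite /Rintegral integral_dirac//; last exact/measurable_EFinP.
    by rewrite diracT mul1e.
  have [_ H1] := Rintegral_law (nu := \d_(m : measurableTypeR R)) law mcos icos.
  have [_ H2] := Rintegral_law (nu := \d_(m : measurableTypeR R)) law mid iL.
  have [_ H3] := Rintegral_law (nu := \d_(m : measurableTypeR R)) law msq iL2.
  move: H1 H2 H3; rewrite !dE// EL EL2 => -> <- ->.
  by rewrite expr0n/= mul0r oppr0 expR0 mulr1 add0r.
have law : forall A : set R, measurable A -> P (L @^-1` A) = normal_prob m s A.
  by move=> A mA; rewrite lawL// /normal_law (negbTE s0).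
have [I1 H1] := Rintegral_law (nu := normal_prob m s) law mcos icos.
have [I2 H2] := Rintegral_law (nu := normal_prob m s) law mid iL.
have [I3 H3] := Rintegral_law (nu := normal_prob m s) law msq iL2.
have intpdf := @integrable_normal_pdf R m s.
have intsq := integrable_sqr_normal_pdf m s0.
have mpdf := measurable_normal_pdf m s.
have intxm : lebesgue_measure.-integrable setT (fun x : R => ((x - m) * normal_pdf m s x)%:E).
  apply: (@le_integrable _ _ _ lebesgue_measure _ measurableT _
    (fun x => ((1 + (x - m) ^+ 2) * normal_pdf m s x)%:E)) => //.
    by apply/measurable_EFinP; apply: measurable_funM => //; exact: measurable_funB.
  move=> x _; rewrite lee_fin !normrM (ger0_norm (normal_pdf_ge0 _ _ _)).
  rewrite ler_wpM2r ?normal_pdf_ge0// [leRHS]ger0_norm ?addr_ge0 ?sqr_ge0//.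
  by rewrite -[(x - m) ^+ 2]real_normK ?num_real//; have := normr_ge0 (x - m); nra.
have m0 : m = 0.
  move: H2; rewrite EL Rintegral_normal_prob// => /esym.
  have -> : \int[lebesgue_measure]_x (x * normal_pdf m s x) = \int[lebesgue_measure]_x
      ((x - m) * normal_pdf m s x + m * normal_pdf m s x).
    by apply: eq_Rintegral => x _; ring.
  rewrite RintegralD//; last first.
    by rewrite /comp; under eq_fun do rewrite EFinM; apply: integrableZl.
  by rewrite RintegralZl// normal_pdf_mean// Rintegral_normal_pdf add0r mulr1.
have vE : v = s ^+ 2.
  rewrite -EL2 H3 Rintegral_normal_prob// -(@normal_pdf_var _ m s s0) m0.
  by under [in RHS]eq_Rintegral do rewrite subr0.
rewrite H1 Rintegral_normal_prob// vE.
have := normal_pdf_cos m s0 1 b; rewrite m0.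
under eq_Rintegral do rewrite mul1r subr0.
by move=> ->; rewrite expr1n mul1r.
Qed.

End centered_normal_law.

(** The characteristic function of the centred normal law with covariance K, kept real: the free
    phase b supplies both its real and its imaginary part. *)
Definition gaussian_family d (T : measurableType d) (R : realType)
    (P : probability T R) (n : nat) (X : 'I_n -> T -> R)
    (K : 'I_n -> 'I_n -> R) : Prop :=
  (forall i, measurable_fun setT (X i)) /\
  forall (a : 'I_n -> R) (b : R),
    \int[P]_w cos (\sum_i a i * X i w + b) =
    cos b * expR (- (\sum_i \sum_j a i * a j * K i j) / 2).

Section jointly_normal_gaussian_family.
Context d (T : measurableType d) (R : realType) (P : probability T R).

Lemma jointly_normal_gaussian_family n (Z : 'I_n -> {RV P >-> R})
    (K : 'I_n -> 'I_n -> R) :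
  jointly_normal Z ->
  (forall i, 'E_P[Z i] = 0)%E ->
  (forall j k, 'E_P[fun w => (Z j w * Z k w)%R] = (K j k)%:E)%E ->
  gaussian_family P (fun i => Z i : T -> R) K.
Proof.
move=> jn EZ EZZ; have mZ i : measurable_fun setT (Z i : T -> R) by [].
split => // a b; rewrite mulNr.
(* The second moment is finite because it equals the real number K i i. Squares then dominate the
   products and the variables themselves, so every moment of a linear combination may be
   expanded. *)
have iZ2 i : P.-integrable setT (fun w => (Z i w ^+ 2)%:E).
  apply/integrableP; split; first exact/measurable_EFinP/measurable_funX.
  have := EZZ i i; rewrite unlock => h.
  rewrite (eq_integral (fun w => (Z i w * Z i w)%:E)); last first.
    by move=> w _; rewrite /= ger0_norm ?expr2// -expr2 sqr_ge0.
  by rewrite h ltry.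
have iZZ i j : P.-integrable setT (fun w => (Z i w * Z j w)%:E).
  apply: (@le_integrable _ _ _ P _ measurableT _
    (fun w => ((Z i w ^+ 2)%:E + (Z j w ^+ 2)%:E)%E)).
  - by apply/measurable_EFinP/measurable_funM.
  - move=> w _; rewrite -EFinD lee_fin [leRHS]ger0_norm ?addr_ge0 ?sqr_ge0//.
    rewrite ler_norml; apply/andP; split.
      by have := sqr_ge0 (Z i w + Z j w); have := sqr_ge0 (Z i w); have := sqr_ge0 (Z j w); lra.
    by have := sqr_ge0 (Z i w - Z j w); have := sqr_ge0 (Z i w); have := sqr_ge0 (Z j w); lra.
  - by apply: integrableD.
have iZ i : P.-integrable setT (fun w => (Z i w)%:E).
  apply: (@le_integrable _ _ _ P _ measurableT _
    (fun w => (1%:E + (Z i w ^+ 2)%:E)%E)).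
  - exact/measurable_EFinP.
  - move=> w _; rewrite -EFinD lee_fin [leRHS]ger0_norm ?addr_ge0 ?sqr_ge0//.
    by rewrite -[Z i w ^+ 2]real_normK ?num_real//; have := normr_ge0 (Z i w); nra.
  - by apply: integrableD => //; exact: finite_measure_integrable_cst.
pose L w := \sum_i a i * Z i w.
have L2E w : L w ^+ 2 = \sum_i \sum_j a i * a j * (Z i w * Z j w).
  rewrite expr2 mulr_suml; apply: eq_bigr => i _.
  by rewrite mulr_sumr; apply: eq_bigr => j _; rewrite mulrACA.
have isum (I : finType) (c : I -> R) (F : I -> T -> R) :
    (forall i, P.-integrable setT (fun w => (F i w)%:E)) ->
    P.-integrable setT (fun w => (\sum_i c i * F i w)%:E) /\
    \int[P]_w (\sum_i c i * F i w) = \sum_i c i * \int[P]_w F i w.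
  move=> iF.
  have icF i : P.-integrable setT (fun w => (c i * F i w)%:E).
    by under eq_fun do rewrite EFinM; apply: integrableZl.
  elim: (index_enum I) => [|i s [ih1 ih2]].
    split; first by under eq_fun do rewrite big_nil; exact: finite_measure_integrable_cst.
    rewrite big_nil; under eq_Rintegral do rewrite big_nil.
    by rewrite Rintegral_cst// mul0r.
  split.
    under eq_fun do rewrite big_cons EFinD.
    exact: integrableD.
  under eq_Rintegral do rewrite big_cons.
  rewrite (RintegralD measurableT (icF i) ih1) ih2 RintegralZl//; last exact: iF.
  by rewrite big_cons.
have [iL EL] := isum 'I_n a (fun i w => Z i w) iZ.
have [iL2 EL2] := isum ('I_n * 'I_n)%type (fun p => a p.1 * a p.2)
  (fun p w => Z p.1 w * Z p.2 w) (fun p => iZZ p.1 p.2).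
have L2E' w : L w ^+ 2 = \sum_(p : 'I_n * 'I_n) (a p.1 * a p.2) * (Z p.1 w * Z p.2 w).
  by rewrite L2E pair_bigA.
have mL : measurable_fun setT L by apply: measurable_sum => i; exact: measurable_funM.
apply: (Rintegral_cos_normal_law mL (jn a)) => //.
- by under eq_fun do rewrite L2E'.
- rewrite EL big1// => i _; have := EZ i; rewrite unlock /Rintegral => ->.
  by rewrite mulr0.
- rewrite pair_bigA/=; under eq_Rintegral do rewrite L2E'.
  rewrite EL2; apply: eq_bigr => -[i j] _ /=.
  by have := EZZ i j; rewrite unlock /Rintegral => ->.
Qed.

End jointly_normal_gaussian_family.

Section gaussian_family_operations.
Context (R : realType).

Lemma gaussian_family_measurable_cos d (T : measurableType d)
    (P : probability T R) n (X : 'I_n -> T -> R) K (a : 'I_n -> R) (b : R) :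
  gaussian_family P X K ->
  measurable_fun setT (fun w => cos (\sum_i a i * X i w + b)).
Proof.
move=> [mX _]; apply: measurableT_comp.
  by apply: continuous_measurable_fun; exact: continuous_cos.
apply: measurable_funD => //; apply: measurable_sum => i.
exact: measurable_funM.
Qed.

Lemma gaussian_familyZ d (T : measurableType d) (P : probability T R) n
    (X : 'I_n -> T -> R) K (c : R) : gaussian_family P X K ->
  gaussian_family P (fun i w => c * X i w) (fun i j => c ^+ 2 * K i j).
Proof.
move=> [mX EX]; split => [i|a b]; first exact: measurable_funM.
have -> : \int[P]_w cos (\sum_i a i * (c * X i w) + b) =
    \int[P]_w cos (\sum_i (a i * c) * X i w + b).
  by under eq_Rintegral do under eq_bigr do rewrite mulrA.
have S : \sum_i \sum_j a i * c * (a j * c) * K i j =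
    \sum_i \sum_j a i * a j * (c ^+ 2 * K i j).
  by apply: eq_bigr => i _; apply: eq_bigr => j _; ring.
by rewrite EX S.
Qed.

(** The free phase absorbs the first variable, so the inner integral is an instance of the
    hypothesis on Y and leaves a cosine for the hypothesis on X. *)
Lemma gaussian_family_prodD d1 d2 (T1 : measurableType d1)
    (T2 : measurableType d2) (P : probability T1 R) (Q : probability T2 R) n
    (X : 'I_n -> T1 -> R) (Y : 'I_n -> T2 -> R) KX KY :
  gaussian_family P X KX -> gaussian_family Q Y KY ->
  gaussian_family (prodP P Q) (fun i w => X i w.1 + Y i w.2)
    (fun i j => KX i j + KY i j).
Proof.
move=> GX GY; have [mX EX] := GX; have [mY EY] := GY.
have mXY i : measurable_fun setT (fun w : T1 * T2 => X i w.1 + Y i w.2).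
  apply: measurable_funD.
    exact: (measurableT_comp (mX i) measurable_fst).
  exact: (measurableT_comp (mY i) measurable_snd).
split => // a b; rewrite (@prodP_Rintegral _ _ _ _ _ _ _ _ 1).
- have inner x : \int[Q]_y cos (\sum_i a i * (X i (x, y).1 + Y i (x, y).2) + b) =
      expR (- (\sum_i \sum_j a i * a j * KY i j) / 2) * cos (\sum_i a i * X i x + b).
    rewrite mulrC -EY; apply: eq_Rintegral => y _ /=; congr cos.
    under eq_bigr do rewrite mulrDr.
    by rewrite big_split/= addrAC addrA addrC addrA.
  under eq_Rintegral do rewrite inner.
  rewrite RintegralZl//; last first.
    apply: (@bounded_integrable _ _ _ _ _ 1).
      exact: gaussian_family_measurable_cos GX.
    by move=> w /=; rewrite ler_norml cos_geN1 cos_le1.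
  have S : \sum_i \sum_j a i * a j * (KX i j + KY i j) =
      \sum_i \sum_j a i * a j * KX i j + \sum_i \sum_j a i * a j * KY i j.
    rewrite -big_split; apply: eq_bigr => i _ /=.
    by rewrite -big_split; apply: eq_bigr => j _ /=; rewrite mulrDr.
  by rewrite EX S mulrCA -expRD -mulrDl -opprD addrC.
- apply: measurableT_comp.
    by apply: continuous_measurable_fun; exact: continuous_cos.
  apply: measurable_funD => //; apply: measurable_sum => i.
  exact: measurable_funM.
- by move=> w /=; rewrite ler_norml cos_geN1 cos_le1.
Qed.

(** Coefficients with the same image under g are added up, so g may be any map; it serves to
    restrict a family to an initial segment of indices. *)
Lemma gaussian_family_reindex d (T : measurableType d) (P : probability T R)
    n m (g : 'I_m -> 'I_n) (X : 'I_n -> T -> R) K :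
  gaussian_family P X K ->
  gaussian_family P (fun i => X (g i)) (fun i j => K (g i) (g j)).
Proof.
move=> [mX EX]; split => // a b.
pose a' k := \sum_(i | g i == k) a i.
have sumE (F : 'I_n -> R) : \sum_i a i * F (g i) = \sum_k a' k * F k.
  rewrite (partition_big g xpredT)//=; apply: eq_bigr => k _.
  by rewrite /a' mulr_suml; apply: eq_bigr => i /eqP ->.
under eq_Rintegral do rewrite (sumE (fun k => X k _)).
have S : \sum_i \sum_j a i * a j * K (g i) (g j) = \sum_i \sum_j a' i * a' j * K i j.
  transitivity (\sum_i a i * \sum_j a j * K (g i) (g j)).
    by apply: eq_bigr => i _; rewrite mulr_sumr; apply: eq_bigr => j _; rewrite mulrA.
  rewrite (sumE (fun k => \sum_j a j * K k (g j))); apply: eq_bigr => k _.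
  by rewrite (sumE (K k)) mulr_sumr; apply: eq_bigr => j _; rewrite mulrA.
by rewrite EX S.
Qed.

End gaussian_family_operations.

(** * Products of trigonometric sums and Slepian's inequality for them *)

Section cos_products.
Context (R : realType).
Import complex.
Local Open Scope complex_scope.

Definition cis (t : R) : R[i] := cos t +i* sin t.

Lemma cisD s t : cis (s + t) = cis s * cis t.
Proof.
rewrite /cis cosD sinD; apply/eqP; rewrite eq_complex/=; apply/andP; split; apply/eqP; ring.
Qed.

Lemma cis_sum (I : finType) (t : I -> R) : cis (\sum_i t i) = \prod_i cis (t i).
Proof.
apply: (big_morph cis cisD).
by rewrite /cis cos0 sin0.
Qed.

(* The vanishing of the sine sums makes each factor the value of an
   exponential sum, so that no sign patterns are needed in the expansion. *)
Lemma prod_sum_cos (I J : finType) (c t : I -> J -> R) :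
  (forall i, \sum_j c i j * sin (t i j) = 0) ->
  \prod_i \sum_j c i j * cos (t i j) =
  \sum_(phi : {ffun I -> J}) (\prod_i c i (phi i)) * cos (\sum_i t i (phi i)).
Proof.
move=> c0.
have E i : (\sum_j c i j * cos (t i j))%:C = \sum_j (c i j)%:C * cis (t i j).
  have -> : \sum_j (c i j)%:C * cis (t i j) =
      (\sum_j c i j * cos (t i j)) +i* (\sum_j c i j * sin (t i j)).
    elim/big_rec3 : _ => [//|j x y z _ ->].
    by apply/eqP; rewrite eq_complex/= !mul0r subr0 addr0 !eqxx.
  by rewrite c0.
have : (\prod_i \sum_j c i j * cos (t i j))%:C =
    (\sum_(phi : {ffun I -> J}) (\prod_i c i (phi i)) * cos (\sum_i t i (phi i))) +i*
    (\sum_(phi : {ffun I -> J}) (\prod_i c i (phi i)) * sin (\sum_i t i (phi i))).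
  rewrite rmorph_prod/=; under eq_bigr do rewrite E.
  rewrite bigA_distr_bigA/=.
  elim/big_rec3 : _ => [//|phi x y z _ ->].
  rewrite big_split/= -cis_sum -rmorph_prod/=.
  by apply/eqP; rewrite eq_complex/= !mul0r subr0 addr0 !eqxx.
by case.
Qed.

End cos_products.

Section trigonometric_sums.
Context (R : realType).
Variables (nt : nat) (c a b : 'I_nt -> R).

Definition trig_sum (y : R) := \sum_l c l * cos (a l * y + b l).

Definition trig_sum' (y : R) := - \sum_l c l * a l * sin (a l * y + b l).

Variables (n : nat) (s t : 'I_n -> R).

(** A cosine is half the sum of two opposite exponentials, and the boolean chooses the sign. With
    both signs present the sine sums cancel as [prod_sum_cos] requires; [freq] and [phase] describe
    one term of the expanded product. *)
Let J := ('I_nt * bool)%type.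
Let sgn (j : J) : R := (-1) ^+ j.2.
Let coef (phi : {ffun 'I_n -> J}) : R := \prod_i (c (phi i).1 / 2).
Let freq (phi : {ffun 'I_n -> J}) (i : 'I_n) : R := sgn (phi i) * a (phi i).1 * s i.
Let phase (phi : {ffun 'I_n -> J}) : R :=
  \sum_i sgn (phi i) * (a (phi i).1 * t i + b (phi i).1).

Let sum_sgn (F : 'I_nt -> bool -> R) :
  \sum_(j : J) F j.1 j.2 = \sum_l (F l false + F l true).
Proof.
rewrite -(pair_bigA _ F)/=; apply: eq_bigr => l _.
by rewrite big_bool addrC.
Qed.

(** [D] marks the coordinates in which the product is differentiated. A derivative multiplies a
    cosine by its frequency and advances its phase by pi/2, so the expansion keeps its shape. *)
Lemma prod_trig_sum_deriv (D : pred 'I_n) (x : 'I_n -> R) :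
  \prod_i (if D i then s i * trig_sum' (s i * x i + t i)
           else trig_sum (s i * x i + t i)) =
  \sum_phi (coef phi * \prod_(i | D i) freq phi i) *
    cos (\sum_i freq phi i * x i + phase phi + \sum_(i | D i) pi / 2).
Proof.
pose th i (j : J) := sgn j * (a j.1 * (s i * x i + t i) + b j.1) + (if D i then pi / 2 else 0).
pose cc i (j : J) := c j.1 / 2 * (if D i then sgn j * a j.1 * s i else 1).
have cs (z : R) : cos (z + pi / 2) = - sin z.
  by rewrite cosD cos_pihalf sin_pihalf mulr0 mulr1 sub0r.
have ss (z : R) : sin (z + pi / 2) = cos z.
  by rewrite sinD cos_pihalf sin_pihalf mulr0 mulr1 add0r.
have H1 i : \sum_j cc i j * sin (th i j) = 0.
  rewrite (sum_sgn (fun l e => cc i (l, e) * sin (th i (l, e)))) big1// => l _.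
  rewrite /cc /th /sgn/= expr0 expr1 !mul1r !mulN1r; case: ifP => _.
    by rewrite !ss cosN; ring.
  by rewrite !addr0 sinN; ring.
have H2 i : \sum_j cc i j * cos (th i j) =
   if D i then s i * trig_sum' (s i * x i + t i) else trig_sum (s i * x i + t i).
  rewrite (sum_sgn (fun l e => cc i (l, e) * cos (th i (l, e)))).
  rewrite /cc /th /sgn/=; case: ifP => _.
    rewrite mulrN -mulNr mulr_sumr; apply: eq_bigr => l _.
    by rewrite expr0 expr1 !mul1r !mulN1r !cs sinN; field.
  apply: eq_bigr => l _.
  by rewrite expr0 expr1 !mul1r !mulN1r !addr0 cosN; field.
under eq_bigr do rewrite -H2.
rewrite (prod_sum_cos H1); apply: eq_bigr => phi _; congr (_ * cos _).
  rewrite /cc big_split/=; congr (_ * _).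
  by rewrite [RHS]big_mkcond.
rewrite [X in _ = _ + X]big_mkcond/= /phase -!big_split/=; apply: eq_bigr => i _.
by rewrite /th /freq; congr (_ + _); ring.
Qed.

Lemma prod_trig_sum (x : 'I_n -> R) :
  \prod_i trig_sum (s i * x i + t i) =
  \sum_phi coef phi * cos (\sum_i freq phi i * x i + phase phi).
Proof.
rewrite (prod_trig_sum_deriv pred0); apply: eq_bigr => phi _.
by rewrite !big_pred0_eq mulr1 addr0.
Qed.

(** This is the mixed derivative in two coordinates: the two phase shifts add up to pi, that is, to
    a change of sign. *)
Lemma prod_trig_sum_deriv2 (j k : 'I_n) (x : 'I_n -> R) : j != k ->
  \prod_i (if (i == j) || (i == k) then s i * trig_sum' (s i * x i + t i)
           else trig_sum (s i * x i + t i)) =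
  \sum_phi (- (coef phi * (freq phi j * freq phi k))) *
    cos (\sum_i freq phi i * x i + phase phi).
Proof.
move=> jk; rewrite (prod_trig_sum_deriv (fun i => (i == j) || (i == k))).
have big2 (V : Type) (idx : V) (op : Monoid.com_law idx) (F : 'I_n -> V) :
    \big[op/idx]_(i | (i == j) || (i == k)) F i = op (F j) (F k).
  rewrite (bigD1 j) ?eqxx//= (bigD1 k)/=; last by rewrite eqxx orbT eq_sym.
  rewrite big1 ?Monoid.mulm1// => i /andP[/andP[+ ij] ik].
  by rewrite (negbTE ij) (negbTE ik).
apply: eq_bigr => phi _; rewrite !big2/= (_ : pi / 2 + pi / 2 = pi); last by field.
by rewrite cosDpi mulrN mulNr.
Qed.

Hypothesis f01 : forall y, 0 <= trig_sum y <= 1.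
Variable e : R.
Hypothesis e0 : 0 <= e.
Hypothesis f'f' : forall y z, - e <= trig_sum' y * trig_sum' z.

(** The undifferentiated factors lie in [0, 1], so they can only shrink a negative product of two
    slopes. *)
Lemma prod_trig_sum_deriv2_ge (j k : 'I_n) (x : 'I_n -> R) :
  j != k -> s j = 1 -> s k = 1 ->
  - e <= \prod_i (if (i == j) || (i == k) then s i * trig_sum' (s i * x i + t i)
           else trig_sum (s i * x i + t i)).
Proof.
move=> jk sj sk.
rewrite (bigD1 j)//= (bigD1 k)/=; last by rewrite eq_sym.
rewrite eqxx /= eqxx orbT sj sk !mul1r mulrA.
set p := \prod_(_ < _ | _) _.
have /andP[p0 p1] : 0 <= p <= 1.
  rewrite /p; elim/big_ind : _ => [||i /andP[ij ik]].
  - by rewrite ler01 lexx.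
  - by move=> u v /andP[u0 u1] /andP[v0 v1]; rewrite mulr_ge0 ?mulr_ile1.
  - by rewrite (negbTE ij) (negbTE ik)/=; exact: f01.
have := f'f' (x j + t j) (x k + t k).
set w := trig_sum' _ * _ => we; have [w0|w0] := leP 0 w.
  by apply: (@le_trans _ _ 0); [rewrite oppr_le0|exact: mulr_ge0].
by rewrite (le_trans we)// ler_niMr// ltW.
Qed.

Lemma gaussian_family_trig_expectation d (T : measurableType d)
    (P : probability T R) (X : 'I_n -> T -> R) K (I : finType)
    (w : I -> R) (A : I -> 'I_n -> R) (B : I -> R) :
  gaussian_family P X K ->
  \int[P]_x (\sum_q w q * cos (\sum_i A q i * X i x + B q)) =
  \sum_q w q * (cos (B q) * expR (- (\sum_i \sum_j A q i * A q j * K i j) / 2)).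
Proof.
move=> GX; have [mX EX] := GX.
have icos q : P.-integrable setT (EFin \o (fun x => cos (\sum_i A q i * X i x + B q))).
  apply: (@bounded_integrable _ _ _ _ _ 1).
    exact: gaussian_family_measurable_cos GX.
  by move=> y /=; rewrite ler_norml cos_geN1 cos_le1.
have icF q : P.-integrable setT (EFin \o (fun x => w q * cos (\sum_i A q i * X i x + B q))).
  rewrite /comp; under eq_fun do rewrite EFinM.
  by apply: integrableZl => //; exact: icos.
suff : P.-integrable setT (EFin \o (fun x => \sum_q w q * cos (\sum_i A q i * X i x + B q))) /\
  \int[P]_x (\sum_q w q * cos (\sum_i A q i * X i x + B q)) =
  \sum_q w q * (cos (B q) * expR (- (\sum_i \sum_j A q i * A q j * K i j) / 2)) by case.
elim: (index_enum I) => [|q r [ih1 ih2]].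
  split.
    by rewrite /comp; under eq_fun do rewrite big_nil; exact: finite_measure_integrable_cst.
  rewrite big_nil; under eq_Rintegral do rewrite big_nil.
  by rewrite Rintegral_cst// mul0r.
split.
  rewrite /comp; under eq_fun do rewrite big_cons EFinD.
  exact: (integrableD measurableT (icF q) ih1).
under eq_Rintegral do rewrite big_cons.
by rewrite (RintegralD measurableT (icF q) ih1) ih2 RintegralZl// EX big_cons.
Qed.

Lemma is_derive_big_sum (I : Type) (r : seq I) (F : I -> R -> R) (F' : I -> R) (x : R) :
  (forall i, is_derive x 1 (F i) (F' i)) ->
  is_derive x 1 (fun y => \sum_(i <- r) F i y) (\sum_(i <- r) F' i).
Proof.
move=> dF; elim: r => [|i r ih].
  rewrite big_nil (_ : (fun _ => _) = cst 0).
    exact: is_derive_cst.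
  by apply/funext => y; rewrite big_nil.
rewrite big_cons (_ : (fun _ => _) = F i \+ (fun y => \sum_(i <- r) F i y)).
  by have := dF i => dFi; apply: is_deriveD.
by apply/funext => y; rewrite big_cons.
Qed.

(** Along the covariances z KX + (1 - z) KY, the derivative of the expectation is half the sum over
    j, k of (KX - KY) j k times the expected mixed derivative. Pairs with equal covariances drop
    out, and each other pair contributes at least - e |KX j k - KY j k|. *)
Lemma slepian_trig_sum d1 d2 (T1 : measurableType d1) (T2 : measurableType d2)
    (P : probability T1 R) (Q : probability T2 R)
    (X : 'I_n -> T1 -> R) (Y : 'I_n -> T2 -> R) KX KY :
  gaussian_family P X KX -> gaussian_family Q Y KY ->
  (forall i, KX i i = KY i i) ->
  (forall i j, i != j ->
     KX i j = KY i j \/ [/\ s i = 1, s j = 1 & KY i j <= KX i j]) ->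
  \int[Q]_w \prod_i trig_sum (s i * Y i w + t i) <=
  \int[P]_w \prod_i trig_sum (s i * X i w + t i) +
    e * \sum_i \sum_j `|KX i j - KY i j|.
Proof.
move=> GX GY Kd Kij.
pose q (K : 'I_n -> 'I_n -> R) phi := \sum_i \sum_j freq phi i * freq phi j * K i j.
have EF d (T : measurableType d) (M : probability T R) (W : 'I_n -> T -> R) K :
    gaussian_family M W K ->
    \int[M]_w \prod_i trig_sum (s i * W i w + t i) =
    \sum_phi coef phi * (cos (phase phi) * expR (- q K phi / 2)).
  move=> GW; under eq_Rintegral do rewrite prod_trig_sum.
  exact: gaussian_family_trig_expectation.
rewrite (EF _ _ _ _ _ GX) (EF _ _ _ _ _ GY).
(* Both expectations are values, at 1 and at 0, of one explicit sum of exponentials, so the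
   derivative along the interpolation is elementary. *)
pose g phi (x : R) := coef phi * (cos (phase phi) * expR (- (q KY phi + x * (q KX phi - q KY phi)) / 2)).
pose g' phi (x : R) := - ((q KX phi - q KY phi) / 2) * g phi x.
have dg phi (x : R) : is_derive x 1 (g phi) (g' phi x).
  rewrite /g /g'; apply: is_derive_eq; rewrite /GRing.scale/= /g.
  by field.
pose G (x : R) := \sum_phi g phi x.
pose G' (x : R) := \sum_phi g' phi x.
have dG (x : R) : is_derive x 1 G (G' x) by apply: is_derive_big_sum.
have cG : {within `[0, 1], continuous G}.
  apply: continuous_subspaceT => x; apply: differentiable_continuous.
  by apply/derivable1_diffP; case: (dG x).
have [z x01 Gz] := @MVT R G G' 0 1 ltr01 (fun y _ => dG y) cG.
move: Gz.
rewrite subr0 mulr1.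
have -> : G 1 = \sum_phi coef phi * (cos (phase phi) * expR (- q KX phi / 2)).
  by apply: eq_bigr => phi _; rewrite /g mul1r addrC subrK.
have -> : G 0 = \sum_phi coef phi * (cos (phase phi) * expR (- q KY phi / 2)).
  by apply: eq_bigr => phi _; rewrite /g mul0r addr0.
move: x01; rewrite in_itv/= => /andP[x0 x1].
(* [Kt] is the covariance of sqrt(z) X + sqrt(1 - z) Y for independent X and Y. Realising it on the
   product space turns [E j k] back into the expectation of a mixed derivative, which is bounded
   pointwise. *)
pose Kt i j := Num.sqrt z ^+ 2 * KX i j + Num.sqrt (1 - z) ^+ 2 * KY i j.
have GW := gaussian_family_prodD (gaussian_familyZ (Num.sqrt z) GX)
  (gaussian_familyZ (Num.sqrt (1 - z)) GY).
have KtE i j : Kt i j = KY i j + z * (KX i j - KY i j).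
  by rewrite /Kt !sqr_sqrtr ?subr_ge0 ?ltW//; ring.
have qKt phi : q KY phi + z * (q KX phi - q KY phi) = q Kt phi.
  rewrite /q -sumrB mulr_sumr -big_split/=; apply: eq_bigr => i _.
  rewrite -sumrB mulr_sumr -big_split/=; apply: eq_bigr => j _.
  by rewrite KtE; ring.
pose h phi := cos (phase phi) * expR (- q Kt phi / 2).
pose E j k := \sum_phi (- (coef phi * (freq phi j * freq phi k))) * h phi.
have Ege j k : - (e * `|KX j k - KY j k|) <= (KX j k - KY j k) * E j k.
  have [<-|jk] := eqVneq j k; first by rewrite Kd subrr normr0 mulr0 mul0r oppr0.
  have [->|[sj sk KYX]] := Kij _ _ jk; first by rewrite subrr normr0 mulr0 mul0r oppr0.
  rewrite ger0_norm ?subr_ge0// mulrC -mulrN ler_wpM2l ?subr_ge0//.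
  rewrite /E /h -(gaussian_family_trig_expectation _ _ _ GW).
  have e_le y := @prod_trig_sum_deriv2_ge j k y jk sj sk.
  have mF : measurable_fun setT (fun w : T1 * T2 => \sum_phi
      (- (coef phi * (freq phi j * freq phi k))) *
      cos (\sum_i freq phi i * (Num.sqrt z * X i w.1 + Num.sqrt (1 - z) * Y i w.2) + phase phi)).
    apply: measurable_sum => phi; apply: measurable_funM => //.
    exact: gaussian_family_measurable_cos GW.
  have iF : (prodP P Q).-integrable setT (EFin \o (fun w : T1 * T2 => \sum_phi
      (- (coef phi * (freq phi j * freq phi k))) *
      cos (\sum_i freq phi i * (Num.sqrt z * X i w.1 + Num.sqrt (1 - z) * Y i w.2) + phase phi))).
    apply: (@bounded_integrable _ _ _ _ _
      (\sum_phi `|- (coef phi * (freq phi j * freq phi k))|) mF) => w.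
    rewrite (le_trans (ler_norm_sum _ _ _))// ler_sum// => phi _.
    by rewrite normrM ler_piMr// ler_norml cos_geN1 cos_le1.
  have -> : - e = \int[prodP P Q]_w (- e).
    rewrite Rintegral_cst// (_ : fine _ = 1) ?mulr1//.
    by rewrite -[RHS]/(fine 1%E); congr fine; exact: prodP_setT.
  apply: le_Rintegral => //.
    exact: finite_measure_integrable_cst.
  by move=> w _; rewrite -prod_trig_sum_deriv2//.
have G'E : G' z = (\sum_j \sum_k (KX j k - KY j k) * E j k) / 2.
  transitivity (\sum_phi \sum_j \sum_k
    (KX j k - KY j k) * ((- (coef phi * (freq phi j * freq phi k))) * h phi) / 2).
    apply: eq_bigr => phi _; rewrite /g' /g qKt -/(h phi) /q -sumrB.
    rewrite mulr_suml -sumrN mulr_suml; apply: eq_bigr => j _.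
    rewrite -sumrB mulr_suml -sumrN mulr_suml; apply: eq_bigr => k _.
    by field.
  rewrite exchange_big/= mulr_suml; apply: eq_bigr => j _.
  rewrite exchange_big/= mulr_suml; apply: eq_bigr => k _.
  by rewrite /E mulr_sumr mulr_suml.
have : - (e * \sum_i \sum_j `|KX i j - KY i j|) <= \sum_j \sum_k (KX j k - KY j k) * E j k.
  rewrite mulr_sumr -sumrN ler_sum// => j _.
  by rewrite mulr_sumr -sumrN ler_sum.
have : 0 <= e * \sum_i \sum_j `|KX i j - KY i j|.
  by rewrite mulr_ge0// sumr_ge0// => i _; rewrite sumr_ge0.
rewrite G'E; lra.
Qed.

End trigonometric_sums.

(** * Periodic sawtooth approximations of the step function *)

Lemma derive_bounded_lipschitz (R : realType) (F F' : R -> R) (k : R) :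
  (forall x : R, is_derive x 1 F (F' x)) -> (forall x, `|F' x| <= k) ->
  forall x y, `|F x - F y| <= k * `|x - y|.
Proof.
move=> dF F'k x y; wlog xy : x y / x < y.
  move=> H; case: (ltgtP x y) => [/H//|/H|->]; first by rewrite distrC (distrC y).
  by rewrite !subrr normr0 mulr0.
have cF : {within `[x, y], continuous F}.
  apply: continuous_subspaceT => z; apply: differentiable_continuous.
  by apply/derivable1_diffP; case: (dF z).
have [z _ Fz] := @MVT R F F' x y xy (fun z _ => dF z) cF.
by rewrite distrC Fz normrM distrC ler_wpM2r.
Qed.

Lemma normr_sin_le (R : realType) (x : R) : `|sin x| <= `|x|.
Proof.
have := @derive_bounded_lipschitz R sin cos 1 _ _ x 0.
rewrite sin0 !subr0 mul1r; apply => // y.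
by rewrite ler_norml cos_geN1 cos_le1.
Qed.

Lemma one_sub_cos_le (R : realType) (x : R) : 1 - cos x <= x ^+ 2 / 2.
Proof.
have -> : x = x / 2 + x / 2 by field.
set z := x / 2; rewrite cosD -!expr2 cos2sin2.
have : sin z ^+ 2 <= z ^+ 2 by rewrite -(real_normK (num_real (sin z))) -[leRHS](real_normK (num_real z)) lerXn2r ?nnegrE ?normr_ge0// normr_sin_le.
by nra.
Qed.

Lemma exists_expr_le (R : realType) (z : R) : 0 <= z -> z < 1 ->
  forall C e : R, 0 < e -> exists N : nat, C * z ^+ N <= e.
Proof.
move=> z0 z1 C e e0.
have zn : `|z| < 1 by rewrite ger0_norm.
have : C * z ^+ n @[n --> \oo] --> C * 0 by apply: cvgM; [exact: cvg_cst|exact: cvg_expr].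
rewrite mulr0 => /cvgr0Pnorm_le/(_ e e0)[N _ /(_ N (leqnn N))/= H].
by exists N; rewrite (le_trans (ler_norm _)).
Qed.

Section poisson_kernel.
Context (R : realType).
Variable rho : R.
Hypothesis rho0 : 0 <= rho.
Hypothesis rho1 : rho < 1.

(** [den] is |1 - rho e^{iy}|^2, [csum] truncates the real part of the geometric series of (rho
    e^{iy})^l over l >= 1, and [ssum] is its primitive vanishing at 0. *)
Let den (y : R) := 1 - 2 * rho * cos y + rho ^+ 2.
Let csum M (y : R) := \sum_(l < M) rho ^+ l.+1 * cos (l.+1%:R * y).
Let ssum M (y : R) := \sum_(l < M) rho ^+ l.+1 / l.+1%:R * sin (l.+1%:R * y).

(** The imaginary part of -log(1 - rho e^{iy}), that is, the sum of rho^l sin(l y) / l. As rho tends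
    to 1 it tends to (pi - y)/2 on (0, 2 pi), with a steep rise at the multiples of 2 pi. *)
Definition sawtooth (y : R) := atan (rho * sin y / (1 - rho * cos y)).

Let sawtooth' (y : R) := (rho * cos y - rho ^+ 2) / den y.

Let rhoc y : 0 <= rho * (1 - cos y).
Proof. by rewrite mulr_ge0// subr_ge0 cos_le1. Qed.

Let den_ge y : (1 - rho) ^+ 2 <= den y.
Proof. by rewrite /den; have := rhoc y; lra. Qed.

Let den_gt0 y : 0 < den y.
Proof. by rewrite (lt_le_trans _ (den_ge y))// exprn_gt0// subr_gt0. Qed.

Lemma one_sub_rho_cos_gt0 y : 0 < 1 - rho * cos y.
Proof. by have := rho1; have := rhoc y; lra. Qed.

Lemma is_derive_sawtooth (y : R) : is_derive y 1 sawtooth (sawtooth' y).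
Proof.
have D0 := one_sub_rho_cos_gt0 y.
have D1 : 1 - rho * cos y != 0 by rewrite gt_eqF.
have dq : is_derive y 1 (fun y => rho * sin y / (1 - rho * cos y))
    ((rho * cos y - rho ^+ 2) / (1 - rho * cos y) ^+ 2).
  have dV : is_derive y 1 (fun y => (1 - rho * cos y)^-1)
      (- (1 - rho * cos y) ^- 2 * (rho * sin y)).
    apply: is_derive_eq; rewrite /GRing.scale/=; field.
    by [].
  apply: is_derive_eq; rewrite /GRing.scale/=.
  have s2 : sin y ^+ 2 = 1 - cos y ^+ 2 by rewrite sin2cos2.
  have -> : rho * sin y * (- (1 - rho * cos y) ^- 2 * (rho * sin y)) =
     - (1 - rho * cos y) ^- 2 * rho ^+ 2 * sin y ^+ 2 by ring.
  by rewrite s2; field.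
rewrite /sawtooth; apply: is_derive_eq.
rewrite /GRing.scale/= /sawtooth'.
have -> : den y = (1 - rho * cos y) ^+ 2 + (rho * sin y) ^+ 2.
  by rewrite exprMn sin2cos2 /den; ring.
have D2 : (1 - rho * cos y) ^+ 2 + (rho * sin y) ^+ 2 != 0.
  by rewrite gt_eqF// ltr_pwDl ?sqr_ge0// exprn_gt0.
by field; rewrite D1 D2.
Qed.

(** Truncated geometric series: 2 cos y cos(l y) = cos((l + 1) y) + cos((l - 1) y) makes the product
    telescope. *)
Let den_csum M y : den y * csum M y =
  rho * cos y - rho ^+ 2 - rho ^+ M.+1 * cos (M.+1%:R * y)
  + rho ^+ M.+2 * cos (M%:R * y).
Proof.
elim: M => [|M ih].
  by rewrite /csum big_ord0 mulr0 mul1r mul0r cos0; ring.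
rewrite /csum big_ord_recr/= mulrDr -/(csum M y) ih.
have -> : M.+2%:R * y = M.+1%:R * y + y by rewrite -natr1; ring.
have -> : M%:R * y = M.+1%:R * y - y by rewrite -natr1; ring.
rewrite cosB cosD /den !exprS; ring.
Qed.

Let is_derive_ssum M (y : R) : is_derive y 1 (ssum M) (csum M y).
Proof.
apply: is_derive_big_sum => l; apply: is_derive_eq; rewrite /GRing.scale/=.
by field.
Qed.

Let csum_sawtooth' M y :
  `|csum M y - sawtooth' y| <= 2 * rho ^+ M.+1 / (1 - rho) ^+ 2.
Proof.
have dp := den_gt0 y; have dn : den y != 0 by rewrite gt_eqF.
have -> : csum M y - sawtooth' y =
    (rho ^+ M.+2 * cos (M%:R * y) - rho ^+ M.+1 * cos (M.+1%:R * y)) / den y.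
  apply: (mulfI dn); rewrite mulrBr den_csum /sawtooth'; by field.
have r0 : 0 <= rho ^+ M.+1 by rewrite exprn_ge0.
have c1 := cos_le1 (M%:R * y); have c2 := cos_geN1 (M%:R * y).
have c3 := cos_le1 (M.+1%:R * y); have c4 := cos_geN1 (M.+1%:R * y).
rewrite normrM normfV (gtr0_norm dp) ler_pdivrMr//.
apply: (@le_trans _ _ (2 * rho ^+ M.+1)).
  rewrite (le_trans (ler_normB _ _))// !normrM (ger0_norm r0) ger0_norm ?exprn_ge0//.
  have n1 : `|cos (M%:R * y)| <= 1 by rewrite ler_norml c1 c2.
  have n2 : `|cos (M.+1%:R * y)| <= 1 by rewrite ler_norml c3 c4.
  have n3 : rho ^+ M.+2 <= rho ^+ M.+1 by rewrite exprS ler_piMl// ltW.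
  have n4 : 0 <= rho ^+ M.+2 by rewrite exprn_ge0.
  have -> : 2 * rho ^+ M.+1 = rho ^+ M.+1 + rho ^+ M.+1 by ring.
  rewrite lerD//; last by rewrite ler_piMr.
  by rewrite (le_trans _ n3)// ler_piMr.
rewrite -[leLHS]mulr1 -[leRHS]mulrA ler_wpM2l//; first by rewrite mulr_ge0.
by rewrite mulrC ler_pdivlMr ?exprn_gt0 ?subr_gt0// mul1r.
Qed.

(** Integrating the derivative bound from 0 gives an error proportional to |y|, which is not
    uniform. For fixed y it becomes negligible after N further terms with N large, and those terms
    cost at most a geometric tail that does not depend on y. *)
Let ssum_sawtooth M y : `|ssum M y - sawtooth y| <= rho ^+ M.+1 / (1 - rho).
Proof.
have r1 : 0 < 1 - rho by rewrite subr_gt0.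
have ssum0 N : ssum N 0 = 0.
  by rewrite /ssum big1// => l _; rewrite mulr0 sin0 mulr0.
have saw0 : sawtooth 0 = 0 by rewrite /sawtooth sin0 mulr0 mul0r atan0.
have pt N : `|ssum N y - sawtooth y| <= 2 * rho ^+ N.+1 / (1 - rho) ^+ 2 * `|y|.
  have := @derive_bounded_lipschitz R (fun y => ssum N y - sawtooth y)
    (fun y => csum N y - sawtooth' y) _ _ (csum_sawtooth' N) y 0.
  rewrite ssum0 saw0 !subr0; apply => x.
  have d1 := is_derive_ssum N x; have d2 := is_derive_sawtooth x.
  exact: is_deriveB.
have tail N : `|ssum M y - ssum (M + N) y| <= rho ^+ M.+1 / (1 - rho).
  have -> : ssum M y - ssum (M + N) y =
      - \sum_(l < N) rho ^+ (M + l).+1 / (M + l).+1%:R * sin ((M + l).+1%:R * y).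
    by rewrite /ssum big_split_ord/= opprD addrA subrr add0r.
  rewrite normrN (le_trans (ler_norm_sum _ _ _))//.
  apply: (@le_trans _ _ (\sum_(l < N) rho ^+ M.+1 * rho ^+ l)).
    apply: ler_sum => l _; rewrite !normrM -addSn exprD.
    rewrite (ger0_norm (mulr_ge0 _ _)) ?exprn_ge0//.
    rewrite -mulrA ler_piMr ?mulr_ge0 ?exprn_ge0//.
    rewrite mulr_ile1// ?normr_ge0//; last by rewrite ler_norml sin_geN1 sin_le1.
    by rewrite normfV ger0_norm// invf_le1 ?ler1n ?ltr0n.
  rewrite -mulr_sumr ler_wpM2l ?exprn_ge0//.
  rewrite -[leRHS]mul1r ler_pdivlMr// mulrC -opprB mulNr -subrX1 opprB.
  by rewrite gerBl exprn_ge0.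
apply/ler_addgt0Pr => e e0.
have [N HN] := exists_expr_le rho0 rho1 (2 * rho ^+ M.+1 / (1 - rho) ^+ 2 * `|y|) e0.
rewrite (le_trans (ler_distD (ssum (M + N) y) _ _))// lerD// (le_trans (pt _))//.
by rewrite -addSn exprD; apply: le_trans HN; rewrite le_eqVlt; apply/orP; left; apply/eqP; ring.
Qed.

(** The bound 1/2 on downward slopes is independent of rho, while upward slopes may reach order 1/(1
    - rho). The step function uses the sawtooth with a minus sign, so its upward slopes are the
    small ones. *)
Let sawtooth'_ge y : - 2^-1 <= sawtooth' y.
Proof.
rewrite /sawtooth' ler_pdivlMr//.
have : 0 <= (1 - rho) * (1 + rho).
  by apply: mulr_ge0; [rewrite subr_ge0 ltW|rewrite addr_ge0].
by rewrite /den; lra.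
Qed.

Let sawtooth'_le y : sawtooth' y <= (1 - rho)^-1.
Proof.
have r1 : 0 < 1 - rho by rewrite subr_gt0.
rewrite /sawtooth' ler_pdivrMr// [leRHS]mulrC ler_pdivlMr//.
apply: le_trans (den_ge y).
have : 0 <= (1 - rho) * (rho * (1 - cos y)) by rewrite mulr_ge0 ?rhoc// ltW.
have : 0 <= (1 - rho) * (1 - rho) ^+ 2 by rewrite mulr_ge0 ?sqr_ge0// ltW.
by nra.
Qed.

Lemma sawtooth_approximation (e : R) : 0 < e -> exists M : nat,
  let S y := \sum_(l < M) rho ^+ l.+1 / l.+1%:R * sin (l.+1%:R * y) in
  let C y := \sum_(l < M) rho ^+ l.+1 * cos (l.+1%:R * y) in
  forall y, [/\ `|S y - sawtooth y| <= e, - 2^-1 - e <= C y & C y <= (1 - rho)^-1 + e].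
Proof.
move=> e0; have r1 : 0 < 1 - rho by rewrite subr_gt0.
have [N HN] := exists_expr_le rho0 rho1 (2 * rho / (1 - rho) ^+ 2) e0.
have HN' : 2 * rho ^+ N.+1 / (1 - rho) ^+ 2 <= e.
  by rewrite exprS; apply: le_trans HN; rewrite le_eqVlt; apply/orP; left; apply/eqP; ring.
exists N => S C y.
have H1 := le_trans (csum_sawtooth' N y) HN'.
have H2 := ssum_sawtooth N y.
split.
- apply: le_trans H2 _; apply: le_trans HN'.
  have A0 : 0 <= rho ^+ N.+1 / (1 - rho) by rewrite divr_ge0 ?exprn_ge0// ltW.
  have -> : 2 * rho ^+ N.+1 / (1 - rho) ^+ 2 = 2 * (rho ^+ N.+1 / (1 - rho)) / (1 - rho).
    by field; rewrite gt_eqF.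
  rewrite ler_pdivlMr//; have := mulr_ge0 A0 rho0; lra.
- by move: H1; rewrite ler_norml => /andP[]; have := sawtooth'_ge y; rewrite -/(C y) /csum /C; lra.
- by move: H1; rewrite ler_norml => /andP[_]; have := sawtooth'_le y; rewrite -/(C y) /csum /C; lra.
Qed.

End poisson_kernel.

Section step_function_approximation.
Context (R : realType).

(* Sharpness [1 - rho = K^-3] against period of order [K^2]: the transition
   width tends to 0, the period to infinity, and the product of the largest
   positive and negative slopes to 0. *)
Definition smooth_step (k : nat) (y : R) : R :=
  2^-1 - sawtooth (1 - k.+1%:R ^- 3) (y / k.+1%:R ^+ 2) / pi.

(** With K = k + 1, the unscaled slopes lie between -1/2 - e and K^3 + e, so a product of two is at
    least -K^3. The argument y / K^2 contributes K^-2 to each slope, which leaves -K^3 / K^4 =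
    -1/K. *)
Lemma smooth_step_trig_sum (k : nat) :
  exists (nt : nat) (c a b : 'I_nt -> R),
    [/\ forall y, 0 <= trig_sum c a b y <= 1,
        forall y z, - k.+1%:R^-1 <= trig_sum' c a b y * trig_sum' c a b z &
        forall y, `|trig_sum c a b y - smooth_step k y| <= k.+1%:R^-1].
Proof.
set K : R := k.+1%:R.
have K1 : 1 <= K by rewrite /K ler1n.
have K0 : 0 < K by rewrite (lt_le_trans ltr01).
have Kn0 : K != 0 by rewrite gt_eqF.
pose rho : R := 1 - K ^- 3.
have rho0 : 0 <= rho by rewrite subr_ge0 invf_le1 ?exprn_gt0// exprn_ege1.
have rho1 : rho < 1 by rewrite gtrBl invr_gt0 exprn_gt0.
pose e := (4 * K)^-1.
have e0 : 0 < e by rewrite invr_gt0 mulr_gt0.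
have eK : K * e = 4^-1 by rewrite /e; field.
have e4 : e <= 4^-1 by rewrite -eK ler_peMl// ltW.
have [M HM] := sawtooth_approximation rho0 rho1 e0.
set S := (fun y : R => \sum_(l < M) rho ^+ l.+1 / l.+1%:R * sin (l.+1%:R * y)) in HM.
set C := (fun y : R => \sum_(l < M) rho ^+ l.+1 * cos (l.+1%:R * y)) in HM.
have pi2 : 2 <= pi :> R := pi_ge2 R.
have pi0 : 0 < pi :> R := pi_gt0 R.
have e21 : 1 <= 1 + 2 * e by rewrite lerDl mulr_ge0// ltW.
have e20 : 0 < 1 + 2 * e by rewrite (lt_le_trans ltr01).
(* Truncation may leave [0, 1] by e on either side; adding e and dividing by 1 + 2e restores the
   range. Term 0 is the constant, with frequency 0, and the phase -pi/2 turns the sines into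
   cosines. *)
pose c (l : 'I_M.+1) := if l == ord0 then (2^-1 + e) / (1 + 2 * e)
  else - (rho ^+ l / l%:R / pi / (1 + 2 * e)).
pose a (l : 'I_M.+1) : R := l%:R / K ^+ 2.
pose b (l : 'I_M.+1) : R := if l == ord0 then 0 else - (pi / 2).
have fE y : trig_sum c a b y = (2^-1 - S (y / K ^+ 2) / pi + e) / (1 + 2 * e).
  rewrite /trig_sum big_ord_recl {1}/c /a /b eqxx !mul0r addr0 cos0 mulr1.
  have -> : (2^-1 - S (y / K ^+ 2) / pi + e) / (1 + 2 * e) =
     (2^-1 + e) / (1 + 2 * e) + \sum_(l < M) - (rho ^+ l.+1 / l.+1%:R * sin (l.+1%:R * (y / K ^+ 2)) / pi / (1 + 2 * e)).
    by rewrite sumrN -!mulr_suml -/(S _); ring.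
  congr (_ + _); apply: eq_bigr => l _; rewrite /c /= cosBpihalf /bump/= add1n.
  rewrite (_ : l.+1%:R / K ^+ 2 * y = l.+1%:R * (y / K ^+ 2)); last by ring.
  by ring.
have f'E y : trig_sum' c a b y = - (C (y / K ^+ 2) / (pi * K ^+ 2 * (1 + 2 * e))).
  rewrite /trig_sum' big_ord_recl [X in - (X + _)](_ : _ = 0) ?add0r; last first.
    by rewrite /a !mul0r mulr0 mul0r.
  rewrite /C mulr_suml; congr (- _); apply: eq_bigr => l _.
  rewrite /c /a /b /= /bump/= add1n.
  rewrite (_ : l.+1%:R / K ^+ 2 * y = l.+1%:R * (y / K ^+ 2)); last by ring.
  rewrite sinBpihalf mulrN.
  have l0 : l.+1%:R != 0 :> R by rewrite pnatr_eq0.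
  have alg (p q E v m w : R) : p != 0 -> q != 0 -> E != 0 -> m != 0 ->
      - (- (v / m / p / E) * (m / q ^+ 2) * w) = v * w / (p * q ^+ 2 * E).
    by move=> p0 q0 E0 m0; field; rewrite p0 q0 E0 m0.
  by apply: alg => //; rewrite gt_eqF.
pose s y := sawtooth rho (y / K ^+ 2) / pi.
have sb y : - 2^-1 <= s y <= 2^-1.
  rewrite /s ler_pdivlMr// ler_pdivrMr//; apply/andP; split.
    by rewrite mulNr [2^-1 * _]mulrC ltW// atan_gtNpi2.
  by rewrite [2^-1 * _]mulrC ltW// atan_ltpi2.
have Ss y : `|S (y / K ^+ 2) / pi - s y| <= e.
  rewrite /s -mulrBl normrM normfV (gtr0_norm pi0) ler_pdivrMr//.
  have [+ _ _] := HM (y / K ^+ 2) => /le_trans; apply.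
  by rewrite ler_peMr ?ltW// (lt_le_trans _ pi2)// ltr1n.
exists M.+1, c, a, b; split.
- move=> y; rewrite fE; have := sb y; have := Ss y; rewrite ler_norml.
  move=> /andP[h1 h2] /andP[h3 h4]; rewrite ler_pdivlMr// ler_pdivrMr//.
  by apply/andP; split; lra.
- move=> y z; rewrite !f'E mulrNN.
  have [_ cy1 cy2] := HM (y / K ^+ 2); have [_ cz1 cz2] := HM (z / K ^+ 2).
  set u := C _ in cy1 cy2 *; set v := C (z / _) in cz1 cz2 *.
  have rK : (1 - rho)^-1 = K ^+ 3 by rewrite /rho opprB addrC subrK invrK.
  rewrite rK in cy2 cz2.
  have K31 : 1 <= K ^+ 3 by rewrite exprn_ege1.
  have uv : - (K ^+ 3) <= u * v by have [u0|u0] := leP 0 u; have [v0|v0] := leP 0 v; nra.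
  have xK : K ^+ 2 <= pi * K ^+ 2 * (1 + 2 * e).
    rewrite mulrAC ler_peMl ?exprn_ge0 ?(ltW K0)// mulr_ege1//.
    by rewrite (le_trans _ pi2)// ler1n.
  set w := pi * _ * _ in xK *.
  have w0 : 0 < w by rewrite (lt_le_trans _ xK)// exprn_gt0.
  rewrite mulf_div ler_pdivlMr ?mulr_gt0//; apply: le_trans uv.
  rewrite mulNr lerN2 ler_pdivlMl// -exprS.
  by rewrite (exprD K 2 2) ler_pM ?exprn_ge0// ltW.
- move=> y; rewrite fE /smooth_step -/K -/rho -/(s y).
  have -> : (2^-1 - S (y / K ^+ 2) / pi + e) / (1 + 2 * e) - (2^-1 - s y) =
    (2 * e * s y - (S (y / K ^+ 2) / pi - s y)) / (1 + 2 * e).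
    apply: (mulIf (lt0r_neq0 e20)); rewrite mulrBl !divfK ?gt_eqF//.
    by move: (S _ / pi) (s y) => p q; field.
  rewrite normrM normfV (gtr0_norm e20) ler_pdivrMr//.
  have := sb y; have := Ss y; rewrite !ler_norml => /andP[h1 h2] /andP[h3 h4].
  have -> : K^-1 = 4 * e by rewrite /e; field.
  have := mulr_ge0 (ltW e0) (ltW e0).
  have := ler_wpM2l (ltW e0) h3; have := ler_wpM2l (ltW e0) h4.
  by move=> s1 s2 ee; apply/andP; split; lra.
Qed.

(** For y > 0 and K = k + 1, sin(y / K^2) has order K^-2 while 1 - rho cos(y / K^2) has order at
    most K^-3. Their quotient tends to infinity and its arctangent to pi/2. Oddness of the sawtooth
    gives the case y < 0. *)
Lemma cvg_smooth_step (y : R) : smooth_step k y @[k --> \oo] --> (1 - Num.sg y) / 2.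
Proof.
have smoothN k x : smooth_step k (- x) = 1 - smooth_step k x.
  rewrite /smooth_step /sawtooth mulNr cosN sinN mulrN mulNr atanN mulNr opprK.
  by move: (_ / pi) => a; field.
wlog y0 : y / 0 <= y.
  move=> H; have [|y0] := leP 0 y; first exact: H.
  rewrite -[y]opprK.
  under eq_fun do rewrite smoothN.
  rewrite sgrN opprK (_ : (1 + _) / 2 = 1 - (1 - Num.sg (- y)) / 2); last by field.
  apply: (@cvgB _ R^o); first exact: cvg_cst.
  by apply: H; rewrite oppr_ge0 ltW.
have [->|yn0] := eqVneq y 0.
  rewrite sgr0 subr0 mul1r; apply: cvg_near_cst; apply: nearW => k.
  by rewrite /smooth_step /sawtooth mul0r sin0 mulr0 mul0r atan0 mul0r subr0.
have yp : 0 < y by rewrite lt_neqAle eq_sym yn0.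
rewrite gtr0_sg// subrr mul0r.
rewrite -(_ : 2^-1 - (pi / 2) / pi = 0); last first.
  by rewrite mulrAC divff ?mul1r ?subrr// gt_eqF ?pi_gt0.
apply: (@cvgB _ R^o); first exact: cvg_cst.
apply: cvgM; last exact: cvg_cst.
apply: cvg_comp; last exact: cvgy_atan.
apply/cvgryPge => A.
near=> k.
set K : R := k.+1%:R.
have K0 : 0 < K by rewrite /K ltr0n.
have kK : k%:R <= K by rewrite /K ler_nat.
have K2 : 2 <= K by apply: le_trans kK; near: k; exact: nbhs_infty_ger.
have Ky : y <= K by apply: le_trans kK; near: k; exact: nbhs_infty_ger.
have KA : `|A| * 4 * (1 + y ^+ 2) / y <= K.
  by apply: le_trans kK; near: k; exact: nbhs_infty_ger.
pose x := y / K ^+ 2.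
have x0 : 0 < x by rewrite divr_gt0// exprn_gt0.
have x1 : x <= 1 by rewrite ler_pdivrMr ?exprn_gt0// mul1r (le_trans Ky)// ler_eXnr// ?ler_eXnr; lra.
have sx : x / 2 <= sin x.
  have [|z] := @MVT R sin cos 0 x x0 (fun z _ => is_derive_sin z).
    by apply: continuous_subspaceT => z; exact: continuous_sin.
  rewrite in_itv/= => /andP[z0 zx]; rewrite sin0 !subr0 => ->.
  by rewrite mulrC ler_wpM2r ?(ltW x0)//; have := one_sub_cos_le z; nra.
have cx := one_sub_cos_le x.
have D0 : 0 < 1 - (1 - K ^- 3) * cos x.
  apply: one_sub_rho_cos_gt0; last by rewrite gtrBl invr_gt0 exprn_gt0.
  by rewrite subr_ge0 invf_le1 ?exprn_gt0// exprn_ege1// (le_trans _ K2)// ler1n.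
rewrite ler_pdivlMr//.
pose Ki := K^-1; have Ki0 : 0 < Ki by rewrite invr_gt0.
have Ki2 : Ki <= 2^-1 by rewrite lef_pV2 ?posrE.
have xE : x = y * Ki ^+ 2 by rewrite /x -exprVn.
have K3 : K ^- 3 = Ki ^+ 3 by rewrite -exprVn.
rewrite K3 in D0 *.
have Ki3 : 0 < Ki ^+ 3 by rewrite exprn_gt0.
have Ki38 : Ki ^+ 3 <= 2^-1.
  rewrite (le_trans _ Ki2)// exprS ler_piMr ?exprn_ile1// ?(ltW Ki0)//.
  by rewrite (le_trans Ki2)// invf_le1// ler1n.
have KA' : `|A| * ((1 + y ^+ 2) * Ki ^+ 3) <= y * Ki ^+ 2 / 4.
  have : `|A| * 4 * (1 + y ^+ 2) <= K * y by move: KA; rewrite ler_pdivrMr.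
  have -> : y * Ki ^+ 2 / 4 = (K * y) * (Ki ^+ 3 / 4).
    by rewrite /Ki; field; rewrite gt_eqF.
  have -> : `|A| * ((1 + y ^+ 2) * Ki ^+ 3) = (`|A| * 4 * (1 + y ^+ 2)) * (Ki ^+ 3 / 4).
    by field.
  by move=> ?; rewrite ler_wpM2r// divr_ge0// ltW.
have c1 := cos_le1 x.
have D1 : 1 - (1 - Ki ^+ 3) * cos x <= (1 + y ^+ 2) * Ki ^+ 3.
  have : x ^+ 2 <= y ^+ 2 * Ki ^+ 3.
    rewrite xE exprMn -exprM ler_wpM2l ?sqr_ge0//.
    by rewrite (exprS Ki 3) ler_piMl ?(ltW Ki3)//; lra.
  by nra.
apply: (@le_trans _ _ (`|A| * ((1 + y ^+ 2) * Ki ^+ 3))).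
  by rewrite (@le_trans _ _ (`|A| * (1 - (1 - Ki ^+ 3) * cos x))) ?ler_wpM2l// ler_wpM2r ?ler_norm// ltW.
rewrite (le_trans KA')// -xE.
by nra.
Unshelve. all: by end_near. Qed.

End step_function_approximation.

(** * Slepian's inequality for indicators *)

Lemma Rintegral_bounded_cvg d (T : measurableType d) (R : realType)
    (P : probability T R) (F : nat -> T -> R) (G : T -> R) (M : R) :
  (forall k, measurable_fun setT (F k)) ->
  (forall k w, `|F k w| <= M) ->
  (forall w, F k w @[k --> \oo] --> G w) ->
  [/\ measurable_fun setT G, forall w, `|G w| <= M &
      \int[P]_w F k w @[k --> \oo] --> \int[P]_w G w].
Proof.
move=> mF FM FG.
have mG : measurable_fun setT G.
  exact: (@measurable_fun_cvg _ _ _ _ F G).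
have GM w : `|G w| <= M.
  have h : `|F k w| @[k --> \oo] --> `|G w| by apply: cvg_norm; exact: FG.
  by apply: (ler_cvg_to h (cvg_cst M)); apply: nearW => k; exact: FM.
split => //.
have iG := bounded_integrable P mG GM.
have [] := @dominated_convergence _ T R P _ measurableT
  (fun k w => (F k w)%:E) (fun w => (G w)%:E) (fun=> M%:E) => //.
- by move=> k; exact/measurable_EFinP.
- exact/measurable_EFinP.
- by apply/aeW => w _; apply: cvg_EFin; [exact: nearW|exact: FG].
- exact: finite_measure_integrable_cst.
- by apply/aeW => w k _; rewrite lee_fin.
move=> _ _ H; apply: fine_cvg; rewrite fineK //.
exact: integrable_fin_num.
Qed.

Lemma cvg_prod_fin (R : realType) (I : finType) (F : nat -> I -> R) (G : I -> R) :
  (forall i, F k i @[k --> \oo] --> G i) ->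
  \prod_i F k i @[k --> \oo] --> \prod_i G i.
Proof.
move=> FG; elim: (index_enum I) => [|i s ih].
  by under eq_fun do rewrite big_nil; rewrite big_nil; exact: cvg_cst.
under eq_fun do rewrite big_cons.
by rewrite big_cons; apply: cvgM.
Qed.

Lemma measurable_last_and_others d (T : measurableType d) (R : realType) n
    (Z : 'I_n.+1 -> T -> R) (S1 S2 : set R) :
  (forall i, measurable_fun setT (Z i)) -> measurable S1 -> measurable S2 ->
  measurable [set w | S1 (Z ord_max w) /\ forall i, i != ord_max -> S2 (Z i w)].
Proof.
move=> mZ mS1 mS2.
rewrite (_ : [set w | _] = (Z ord_max @^-1` S1) `&`
    \bigcap_(i in [set i | i != ord_max]) (Z i @^-1` S2)).
  apply: measurableI; first by rewrite -[_ @^-1` _]setTI; exact: mZ.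
  apply: fin_bigcap_measurable; first exact: finite_finset.
  by move=> i _; rewrite -[_ @^-1` _]setTI; exact: mZ.
by apply/seteqP; split => w /=.
Qed.

Section slepian.
Context (R : realType) d1 d2 (T1 : measurableType d1) (T2 : measurableType d2).
Variables (P : probability T1 R) (Q : probability T2 R).
Variables (n : nat) (X : 'I_n.+1 -> T1 -> R) (Y : 'I_n.+1 -> T2 -> R).
Variables (KX KY : 'I_n.+1 -> 'I_n.+1 -> R).
Hypotheses (GX : gaussian_family P X KX) (GY : gaussian_family Q Y KY).
Hypothesis Kdiag : forall i, KX i i = KY i i.
Hypothesis Koff : forall i j, i != j -> KX i j = KY i j \/
  [/\ i != ord_max, j != ord_max & KY i j <= KX i j].

Let step (y : R) : R := (1 - Num.sg y) / 2.
(** The last coordinate is reflected so that exceeding a level also becomes a decreasing step.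
    [Koff] makes its covariances agree, so the reflection never meets a changed covariance. *)
Let s (i : 'I_n.+1) : R := if i == ord_max then -1 else 1.

Let slepian_step (t : 'I_n.+1 -> R) :
  \int[Q]_w \prod_i step (s i * Y i w + t i) <= \int[P]_w \prod_i step (s i * X i w + t i).
Proof.
have [mX _] := GX; have [mY _] := GY.
pose D : R := \sum_i \sum_j `|KX i j - KY i j|.
have : forall k, exists f : R -> R, [/\ forall y, 0 <= f y <= 1, measurable_fun setT f,
    forall y, `|f y - smooth_step k y| <= k.+1%:R^-1 &
    \int[Q]_w \prod_i f (s i * Y i w + t i) <=
    \int[P]_w \prod_i f (s i * X i w + t i) + k.+1%:R^-1 * D].
  move=> k; have [nt [c [a [b [f01 f'f' fE]]]]] := @smooth_step_trig_sum R k.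
  exists (trig_sum c a b); split => //.
    apply: measurable_sum => l; apply: measurable_funM => //.
    apply: measurableT_comp; first by apply: continuous_measurable_fun; exact: continuous_cos.
    by apply: measurable_funD => //; exact: measurable_funM.
  have := @slepian_trig_sum R nt c a b n.+1 s t f01 k.+1%:R^-1 _ f'f' _ _ T1 T2 P Q X Y KX KY GX GY Kdiag; apply; first by rewrite invr_ge0.
  move=> i j ij; case: (Koff ij) => [->|[im jm KYX]]; [by left|right].
  by rewrite /s (negbTE im) (negbTE jm).
move=> /choice[f Hf].
have fstep y : f k y @[k --> \oo] --> step y.
  have inv0 : k.+1%:R^-1 @[k --> \oo] --> (0 : R) by exact: cvg_harmonic.
  have f0 : f k y - smooth_step k y @[k --> \oo] --> (0 : R).
    apply: norm_cvg0; apply: (@squeeze_cvgr _ _ _ _ (cst 0) _ _ _ _ _ inv0).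
      by apply: nearW => k; rewrite normr_ge0/=; have [] := Hf k.
    exact: cvg_cst.
  rewrite (_ : (fun k => f k y) = (fun k => (f k y - smooth_step k y) + smooth_step k y)).
    rewrite -[step y]add0r; apply: (@cvgD _ R^o); first exact: f0.
    exact: cvg_smooth_step.
  by apply/funext => k; rewrite subrK.
have lim d (T : measurableType d) (M : probability T R) (Z : 'I_n.+1 -> T -> R) :
    (forall i, measurable_fun setT (Z i)) ->
    \int[M]_w \prod_i f k (s i * Z i w + t i) @[k --> \oo] -->
    \int[M]_w \prod_i step (s i * Z i w + t i).
  move=> mZ.
  have [] := @Rintegral_bounded_cvg _ _ R M
    (fun k w => \prod_i f k (s i * Z i w + t i))
    (fun w => \prod_i step (s i * Z i w + t i)) 1 => //.
  - move=> k; apply: measurable_prod => i _; have [_ mf _ _] := Hf k.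
    apply: (measurableT_comp mf); apply: measurable_funD => //.
    exact: measurable_funM.
  - move=> k w; have [f01 _ _ _] := Hf k.
    rewrite ger0_norm; last by apply: prodr_ge0 => i _; have /andP[] := f01 (s i * Z i w + t i).
    by apply: prodr_ile1 => i _; exact: f01.
  - by move=> w; apply: cvg_prod_fin => i; exact: fstep.
have lQ := lim _ _ Q Y mY; have lP := lim _ _ P X mX.
have lP' : \int[P]_w \prod_i f k (s i * X i w + t i) + k.+1%:R^-1 * D @[k --> \oo] -->
    \int[P]_w \prod_i step (s i * X i w + t i) + 0 * D.
  apply: (@cvgD _ R^o) => //; apply: cvgM; [exact: cvg_harmonic|exact: cvg_cst].
rewrite mul0r addr0 in lP'.
by apply: (ler_cvg_to lQ lP'); apply: nearW => k; have [] := Hf k.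
Qed.

(** The limiting step is 1/2 at 0, so products of steps are indicators only off the thresholds.
    Strict inequalities for Y against weak ones for X absorb this in the lower coordinates, and the
    gap from u to v absorbs it in the last one. *)
Lemma slepian_comparison (u v : R) : u < v ->
  fine (Q [set w | v < Y ord_max w /\ forall i, i != ord_max -> Y i w < u]) <=
  fine (P [set w | u < X ord_max w /\ forall i, i != ord_max -> X i w <= u]).
Proof.
move=> uv; have [mX _] := GX; have [mY _] := GY.
set A := [set w | v < _ /\ _]; set B := [set w | u < _ /\ _].
have mA : measurable A.
  apply: (@measurable_last_and_others _ _ R n Y [set x | v < x] [set x | x < u]) => //.
    by rewrite -set_itvoy; exact: measurable_itv.
  by rewrite -set_itvNyo; exact: measurable_itv.
have mB : measurable B.
  apply: (@measurable_last_and_others _ _ R n X [set x | u < x] [set x | x <= u]) => //.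
    by rewrite -set_itvoy; exact: measurable_itv.
  by rewrite -set_itvNyc; exact: measurable_itv.
pose t (i : 'I_n.+1) : R := if i == ord_max then v else - u.
rewrite -!Rintegral_indic//.
have step01 y : 0 <= step y <= 1.
  by rewrite /step; case: sgrP => _; apply/andP; split; lra.
have mstep d (T : measurableType d) (Z : 'I_n.+1 -> T -> R) :
    (forall i, measurable_fun setT (Z i)) ->
    measurable_fun setT (fun w => \prod_i step (s i * Z i w + t i)).
  move=> mZ; apply: measurable_prod => i _.
  have mst : measurable_fun setT step.
    apply: nonincreasing_measurable => // x y xy; rewrite /step.
    by rewrite ler_wpM2r// lerD2l lerN2; case: sgrP; case: sgrP => //; lra.
  apply: (measurableT_comp mst); apply: measurable_funD => //.
  exact: measurable_funM.
have prod01 (F : 'I_n.+1 -> R) : `|\prod_i step (F i)| <= 1.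
  rewrite ger0_norm; last by apply: prodr_ge0 => i _; have /andP[] := step01 (F i).
  by apply: prodr_ile1 => i _; exact: step01.
have ind1 (T : Type) (S : set T) w : `|\1_S w| <= 1 :> R.
  by rewrite indicE; case: (_ \in _); rewrite ?normr1 ?normr0.
apply: (@le_trans _ _ (\int[Q]_w \prod_i step (s i * Y i w + t i))).
  apply: le_Rintegral => //.
  - by apply: (bounded_integrable Q _ (ind1 _ A)).
  - by apply: (bounded_integrable Q (mstep _ _ Y mY)) => w; exact: prod01.
  - move=> w _; rewrite indicE; have [|_] := boolP (w \in A); last first.
      by apply: prodr_ge0 => i _; have /andP[] := step01 (s i * Y i w + t i).
    rewrite inE => -[vY Yu]; rewrite big1// => i _; rewrite /s /t /step.
    case: ifPn => [/eqP ->|im].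
      by rewrite ltr0_sg; [field|rewrite mulN1r addrC subr_lt0].
    by rewrite mul1r ltr0_sg ?subr_lt0 ?Yu//; field.
apply: le_trans (slepian_step t) _.
apply: le_Rintegral => //.
- by apply: (bounded_integrable P (mstep _ _ X mX)) => w; exact: prod01.
- by apply: (bounded_integrable P _ (ind1 _ B)).
move=> w _; rewrite indicE; have [|] := boolP (w \in B).
  by move=> _; apply: le_trans (ler_norm _) (prod01 _).
rewrite notin_setE => nB.
suff [i stepi] : exists i, step (s i * X i w + t i) = 0.
  by rewrite (bigD1 i)//= stepi mul0r.
apply: contrapT => /forallNP nstep; apply: nB; split.
  apply: contrapT => /negP; rewrite -leNgt => Xu; apply: (nstep ord_max).
  rewrite /s /t /step eqxx gtr0_sg ?subrr ?mul0r// mulN1r addrC subr_gt0.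
  exact: le_lt_trans uv.
move=> i im; apply: contrapT => /negP; rewrite -ltNge => uX; apply: (nstep i).
by rewrite /s /t /step (negbTE im) gtr0_sg ?subrr ?mul0r// mul1r subr_gt0.
Qed.

End slepian.

(** * Tails determined by cosine expectations *)

Section standard_normal.
Context (R : realType).

Notation N01 := (normal_prob (0 : R) 1 : probability (measurableTypeR R) R).

Definition gaussian_rv d (T : measurableType d) (P : probability T R)
    (X : T -> R) (v : R) : Prop :=
  measurable_fun setT X /\
  forall t b, \int[P]_w cos (t * X w + b) = cos b * expR (- (t ^+ 2 * v) / 2).

Lemma gaussian_rv_family d (T : measurableType d) (P : probability T R)
    (X : T -> R) (v : R) : gaussian_rv P X v ->
  gaussian_family P (fun _ : 'I_1 => X) (fun _ _ => v).
Proof.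
move=> [mX EX]; split => // a b.
under eq_Rintegral do rewrite big_ord1.
by rewrite EX !big_ord1 expr2.
Qed.

Lemma Rintegral_prob_lt d (T : measurableType d) (P : probability T R)
  (X : T -> R) u : measurable_fun setT X ->
  \int[P]_w \1_[set w | u < X w] w = fine (P [set w | u < X w]) :> R.
Proof.
move=> mX; rewrite Rintegral_indic//.
rewrite (_ : [set w | _] = X @^-1` `]u, +oo[%classic).
  by rewrite -[_ @^-1` _]setTI; apply: mX => //; exact: measurable_itv.
by apply/seteqP; split => w /=; rewrite in_itv/= andbT.
Qed.

Lemma measurable_set_lt d (T : measurableType d) (X : T -> R) u :
  measurable_fun setT X -> measurable [set w | u < X w].
Proof.
move=> mX; rewrite (_ : [set w | _] = X @^-1` `]u, +oo[%classic).
  by rewrite -[_ @^-1` _]setTI; apply: mX => //; exact: measurable_itv.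
by apply/seteqP; split => w /=; rewrite in_itv/= andbT.
Qed.

Lemma measurable_set_le d (T : measurableType d) (X : T -> R) u :
  measurable_fun setT X -> measurable [set w | X w <= u].
Proof.
move=> mX; rewrite (_ : [set w | _] = X @^-1` `]-oo, u]%classic).
  by rewrite -[_ @^-1` _]setTI; apply: mX => //; exact: measurable_itv.
by apply/seteqP; split => w /=; rewrite in_itv.
Qed.

(** With a single coordinate, Slepian's comparison asks only for equal variances. Used in both
    directions it shows that cosine expectations determine the tails; the gap between the two levels
    is sent to 0. *)
Lemma gaussian_rv_tail_le d1 d2 (T1 : measurableType d1) (T2 : measurableType d2)
    (P : probability T1 R) (Q : probability T2 R) (X : T1 -> R) (Y : T2 -> R) v u :
  gaussian_rv P X v -> gaussian_rv Q Y v ->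
  fine (Q [set w | u < Y w]) <= fine (P [set w | u < X w]).
Proof.
move=> GX GY; have [mX _] := GX; have [mY _] := GY.
have le_k k : fine (Q [set w | u + k.+1%:R^-1 < Y w]) <= fine (P [set w | u < X w]).
  have := @slepian_comparison R _ _ _ _ P Q 0 _ _ _ _
    (gaussian_rv_family GX) (gaussian_rv_family GY) (fun=> erefl) _ u (u + k.+1%:R^-1).
  rewrite ltrDl invr_gt0 ltr0n => /(_ _ isT).
  have all1 : forall i : 'I_1, i != ord_max -> False.
    by move=> i; rewrite !ord1.
  have -> : [set w | u + k.+1%:R^-1 < Y w /\ forall i : 'I_1, i != ord_max -> Y w < u] =
     [set w | u + k.+1%:R^-1 < Y w].
    by apply/seteqP; split => w /=; [case|move=> h; split => // i /all1].
  have -> : [set w | u < X w /\ forall i : 'I_1, i != ord_max -> X w <= u] =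
     [set w | u < X w].
    by apply/seteqP; split => w /=; [case|move=> h; split => // i /all1].
  by apply => i j; rewrite !ord1.
have [|||_ _] := @Rintegral_bounded_cvg _ _ R Q
  (fun k => \1_[set w | u + k.+1%:R^-1 < Y w]) (\1_[set w | u < Y w]) 1.
- by move=> k; apply: measurable_indic; exact: measurable_set_lt.
- by move=> k w; rewrite indicE; case: (_ \in _); rewrite ?normr1 ?normr0.
- move=> w; rewrite !indicE; have [|] := boolP (w \in [set w | u < Y w]).
    rewrite inE/= => uY; apply: cvg_near_cst; near=> k.
    rewrite indicE mem_set//= -ltrBrDl invf_plt ?posrE ?subr_gt0//.
    apply: (@lt_le_trans _ _ k%:R); last by rewrite ler_nat.
    near: k; exact: nbhs_infty_gtr.
  rewrite notin_setE => /negP; rewrite -leNgt => Yu.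
  apply: cvg_near_cst; apply: nearW => k.
  rewrite indicE memNset//= => /lt_le_trans /(_ Yu).
  by rewrite gtrDl invr_lt0 ltrn0.
move=> H; rewrite -(Rintegral_prob_lt _ _ mY).
apply: (ler_cvg_to H (cvg_cst _)); apply: nearW => k.
by rewrite Rintegral_prob_lt.
Unshelve. all: by end_near. Qed.

Lemma gaussian_rv_tail_eq d1 d2 (T1 : measurableType d1) (T2 : measurableType d2)
    (P : probability T1 R) (Q : probability T2 R) (X : T1 -> R) (Y : T2 -> R) v u :
  gaussian_rv P X v -> gaussian_rv Q Y v ->
  fine (Q [set w | u < Y w]) = fine (P [set w | u < X w]).
Proof.
by move=> GX GY; apply/eqP; rewrite eq_le !(@gaussian_rv_tail_le _ _ _ _ _ _ _ _ v).
Qed.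

Lemma gaussian_rv_std (s : R) : gaussian_rv N01 (fun x : measurableTypeR R => s * x) (s ^+ 2).
Proof.
have ms : measurable_fun setT (fun x : measurableTypeR R => s * x : R).
  exact: measurable_funM.
split => // t b.
have mcos : measurable_fun setT (fun x : measurableTypeR R => cos (t * (s * x) + b)).
  apply: measurableT_comp; first by apply: continuous_measurable_fun; exact: continuous_cos.
  by apply: measurable_funD => //; exact: measurable_funM.
rewrite Rintegral_normal_prob ?oner_neq0//; last first.
  by apply: (@bounded_integrable _ _ _ N01 _ 1 mcos) => w; rewrite ler_norml cos_geN1 cos_le1.
have := @normal_pdf_cos R 0 1 (oner_neq0 _) (t * s) b.
rewrite expr1n mulr1 exprMn mulNr => <-.
by apply: eq_Rintegral => x _; rewrite subr0 mulrA.
Qed.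

End standard_normal.

(** * Independent normals and the reflection inequality *)

Section independent_normals.
Context (R : realType).

Notation N01 := (normal_prob (0 : R) 1 : probability (measurableTypeR R) R).

Lemma fine_probability_le1 d (T : measurableType d) (P : probability T R)
    (A : set T) : measurable A -> fine (P A) <= 1.
Proof.
move=> mA; rewrite -lee_fin fineK ?fin_num_measure//; exact: probability_le1.
Qed.

Lemma fine_probability_le d (T : measurableType d) (P : probability T R)
    (A B : set T) : measurable A -> measurable B -> A `<=` B ->
  fine (P A) <= fine (P B).
Proof.
move=> mA mB AB; rewrite -lee_fin !fineK ?fin_num_measure//.
by apply: le_measure; rewrite ?inE.
Qed.

Lemma prodP_section d1 d2 (T1 : measurableType d1) (T2 : measurableType d2)
    (P : probability T1 R) (Q : probability T2 R) (A : set (T1 * T2)) :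
  measurable A ->
  fine (prodP P Q A) = \int[P]_x fine (Q [set y | A (x, y)]) /\
  measurable_fun setT (fun x => fine (Q [set y | A (x, y)])).
Proof.
move=> mA.
have SE x : [set y | A (x, y)] = xsection A x.
  by apply/seteqP; split => y; rewrite /xsection/= inE.
have mS x : measurable [set y | A (x, y)] by rewrite SE; exact: measurable_xsection.
split.
  rewrite -Rintegral_indic// (@prodP_Rintegral _ _ _ _ _ _ _ _ 1).
  - apply: eq_Rintegral => x _; by rewrite -(Rintegral_indic Q (mS x)).
  - exact: measurable_indic.
  - by move=> w; rewrite indicE; case: (_ \in _); rewrite ?normr1 ?normr0.
apply: measurableT_comp => //.
by under eq_fun do rewrite SE; exact: (measurable_fun_xsection Q mA).
Qed.

(** Probability that a Gaussian walk started at x, with total step variance v, ends above 0. *)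
Definition normal_walk_tail (v x : R) : R :=
  fine (N01 [set y : measurableTypeR R | 0 < x + Num.sqrt v * y]).

Lemma normal_walk_tailE (v x : R) :
  normal_walk_tail v x = fine (N01 [set y : measurableTypeR R | - x < Num.sqrt v * y]).
Proof.
by congr (fine (N01 _)); apply/seteqP; split => y /=; rewrite -ltrBlDl sub0r.
Qed.

(** By symmetry, - x < sqrt(v) y and - x < - sqrt(v) y are equally likely, and for x > 0 they cover
    the line. *)
Lemma normal_walk_tail_ge (v x : R) : 0 < x -> 2^-1 <= normal_walk_tail v x.
Proof.
move=> x0; rewrite normal_walk_tailE.
have E := @gaussian_rv_tail_eq R _ _ _ _ N01 N01 _ _ _ (- x)
  (gaussian_rv_std (Num.sqrt v)) _.
have GN : gaussian_rv N01 (fun y : measurableTypeR R => - Num.sqrt v * y) (Num.sqrt v ^+ 2).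
  by rewrite -sqrrN; exact: gaussian_rv_std.
have := E _ GN => {}E.
set A := [set y | _] in E *; set B := [set y | - x < Num.sqrt v * y] in E *.
have mA : measurable A by apply: measurable_set_lt; exact: measurable_funM.
have mB : measurable B by apply: measurable_set_lt; exact: measurable_funM.
have : (1 <= N01 A + N01 B)%E.
  rewrite -(probability_setT N01); apply: le_trans (measureU2 _ mA mB).
  apply: le_measure; rewrite ?inE//; first exact: measurableU.
  move=> y _; rewrite /A /B/=.
  have [h|h] := leP 0 (Num.sqrt v * y); [right|left]; first by rewrite (lt_le_trans _ h)// oppr_lt0.
  by rewrite mulNr ltrN2 (lt_trans h).
rewrite -[N01 A]fineK ?fin_num_measure// -[N01 B]fineK ?fin_num_measure//.
by rewrite -EFinD lee_fin E; lra.
Qed.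

Lemma gaussian_family_rv d (T : measurableType d) (P : probability T R)
    (X : 'I_1 -> T -> R) K : gaussian_family P X K ->
  gaussian_rv P (X ord0) (K ord0 ord0).
Proof.
move=> [mX EX]; split => // t b.
have := EX (fun=> t) b; rewrite !big_ord1 expr2 => <-.
by under [in RHS]eq_Rintegral do rewrite big_ord1.
Qed.

Lemma measurable_forall_le d (T : measurableType d) m (F : 'I_m -> T -> R)
    (c : 'I_m -> R) : (forall i, measurable_fun setT (F i)) ->
  measurable [set w | forall i : 'I_m, F i w <= c i].
Proof.
move=> mF; rewrite (_ : [set w | _] = \bigcap_(i in [set: 'I_m]) [set w | F i w <= c i]).
  by apply: fin_bigcap_measurable => // i _; exact: measurable_set_le.
by apply/seteqP; split => w /= h i; [move=> _|]; exact: h.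
Qed.

Lemma measurable_walk_le d (T : measurableType d) m (F : nat -> T -> R)
    (s : nat -> R) (x : R) : (forall i, measurable_fun setT (F i)) ->
  measurable [set w | forall i : 'I_m, x + \sum_(l < i.+1) s l * F l w <= 0].
Proof.
move=> mF; apply: (@measurable_forall_le _ _ m (fun i w => x + \sum_(l < i.+1) s l * F l w) (fun=> 0)).
move=> i; apply: measurable_funD => //; apply: measurable_sum => l.
exact: measurable_funM.
Qed.

(** The third clause is the reflection inequality, proved by conditioning on the first step. If that
    step ends above 0, the remaining tail is at least 1/2 and the lower bound is not positive;
    otherwise the induction hypothesis applies to the walk restarted there. *)
Lemma independent_normals_walk (m : nat) :
  exists (d : measure_display) (S : measurableType d) (Q : probability S R)
    (xi : nat -> S -> R),
  [/\ forall l, measurable_fun setT (xi l),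
      forall (c : nat -> R) b, \int[Q]_w cos (\sum_(l < m) c l * xi l w + b) =
        cos b * expR (- (\sum_(l < m) c l ^+ 2) / 2),
      forall (s : nat -> R) x, 1 - 2 * normal_walk_tail (\sum_(l < m) s l ^+ 2) x <=
        fine (Q [set w | forall i : 'I_m, x + \sum_(l < i.+1) s l * xi l w <= 0]) &
      forall c : nat -> R, fine (Q [set w | forall l : 'I_m, xi l w <= c l]) =
        \prod_(l < m) std_normal_cdf (c l)].
Proof.
elim: m => [|m [d [S [Q [xi [mxi Ecos Lev box]]]]]].
  exists _, (measurableTypeR R), N01, (fun _ y => y).
  have full (A : set (measurableTypeR R)) : (forall w, A w) -> fine (N01 A) = 1.
    move=> AT; rewrite (_ : A = setT); last by apply/seteqP; split => w _ /=.
    by rewrite -[RHS]/(fine 1%E); congr fine; exact: probability_setT.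
  split.
  - by move=> _; exact: measurable_id.
  - move=> c b; under eq_Rintegral do rewrite big_ord0 add0r.
    rewrite big_ord0 oppr0 mul0r expR0 Rintegral_cst//.
    by congr (_ * _); rewrite -[RHS]/(fine 1%E); congr fine; exact: probability_setT.
  - move=> s x; rewrite full; last by move=> w [i i0]; exfalso; move: i0; rewrite ltn0.
    rewrite gerBl mulr_ge0//; apply: fine_ge0; exact: measure_ge0.
  - by move=> c; rewrite full ?big_ord0// => w [i i0]; exfalso; move: i0; rewrite ltn0.
pose xi' l (w : measurableTypeR R * S) : R := if l is l'.+1 then xi l' w.2 else w.1.
have mxi' l : measurable_fun setT (xi' l).
  case: l => [|l]; first exact: measurable_fst.
  exact: (measurableT_comp (mxi l) measurable_snd).
exists _, (measurableTypeR R * S)%type, (prodP N01 Q), xi'.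
have mwalk (s : nat -> R) x := @measurable_walk_le _ _ m.+1 xi' s x mxi'.
split => //.
- move=> c b.
  have step w : \sum_(l < m.+1) c l * xi' l w + b =
      \sum_(l < m) c l.+1 * xi l w.2 + (c 0%N * w.1 + b).
    by rewrite big_ord_recl/= addrCA addrA.
  under eq_Rintegral do rewrite step.
  rewrite (@prodP_Rintegral _ _ _ _ _ _ _ _ 1).
  + have inner (y : measurableTypeR R) :
        \int[Q]_z cos (\sum_(l < m) c l.+1 * xi l (y, z).2 + (c 0%N * (y, z).1 + b)) =
        expR (- (\sum_(l < m) c l.+1 ^+ 2) / 2) * cos (c 0%N * y + b).
      by rewrite mulrC -(Ecos (fun l => c l.+1)).
    under eq_Rintegral do rewrite inner.
    have [mg Eg] := gaussian_rv_std (c 0%N).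
    rewrite RintegralZl//; last first.
      apply: (@bounded_integrable _ _ _ N01 _ 1).
        apply: measurableT_comp; first by apply: continuous_measurable_fun; exact: continuous_cos.
        exact: measurable_funD.
      by move=> w; rewrite ler_norml cos_geN1 cos_le1.
    have := Eg 1 b; under eq_Rintegral do rewrite mul1r.
    move=> ->; rewrite expr1n mul1r mulrCA -expRD big_ord_recl/=.
    by rewrite -mulrDl -opprD addrC.
  + apply: measurableT_comp; first by apply: continuous_measurable_fun; exact: continuous_cos.
    apply: measurable_funD.
      apply: measurable_sum => l; apply: measurable_funM => //.
      exact: (measurableT_comp (mxi l) measurable_snd).
    by apply: measurable_funD => //; apply: measurable_funM => //; exact: measurable_fst.
  + by move=> w; rewrite ler_norml cos_geN1 cos_le1.
- move=> s x; have [-> msec] := prodP_section N01 Q (mwalk s x).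
  pose v := \sum_(l < m) s l.+1 ^+ 2.
  have v0 : 0 <= v by rewrite sumr_ge0// => l _; exact: sqr_ge0.
  (* All steps after the first are merged into one normal of the same total variance. The tail of
     [W] is then both the average of the conditional tails and the tail for the full variance. *)
  pose W (p : measurableTypeR R * measurableTypeR R) : R :=
    s 0%N * p.1 + Num.sqrt v * p.2.
  have GW : gaussian_rv (prodP N01 N01) W (\sum_(l < m.+1) s l ^+ 2).
    have := gaussian_family_rv (gaussian_family_prodD
      (gaussian_rv_family (gaussian_rv_std (s 0%N)))
      (gaussian_rv_family (gaussian_rv_std (Num.sqrt v)))).
    by rewrite sqr_sqrtr// big_ord_recl.
  have mW : measurable [set p | - x < W p].
    by apply: measurable_set_lt; case: GW.
  have [WE mtail] := prodP_section N01 N01 mW.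
  have tailE y : fine (N01 [set z | (- x < W (y, z))%R]) = normal_walk_tail v (x + s 0%N * y).
    by rewrite normal_walk_tailE; congr (fine (N01 _)); apply/seteqP; split => z /=; rewrite /W/=; lra.
  have mtail' : measurable_fun setT
      (fun y : measurableTypeR R => normal_walk_tail v (x + s 0%N * y)).
    by move: mtail; under eq_fun do rewrite tailE.
  have tail01 y z : `|normal_walk_tail y z| <= 1.
    rewrite ger0_norm /normal_walk_tail ?fine_ge0//.
    apply: fine_probability_le1.
    by apply: measurable_set_lt; apply: measurable_funD => //; exact: measurable_funM.
  have itail := bounded_integrable N01 mtail' (fun y => tail01 _ _).
  have i2tail : N01.-integrable setT
      (EFin \o (fun y : measurableTypeR R => 2 * normal_walk_tail v (x + s 0%N * y))).
    rewrite /comp; under eq_fun do rewrite EFinM.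
    by apply: integrableZl => //; exact: itail.
  have i1 : N01.-integrable setT (EFin \o (fun=> 1 : R)).
    exact: finite_measure_integrable_cst.
  have E1 : \int[N01]_y (1 - 2 * normal_walk_tail v (x + s 0%N * y)) =
      1 - 2 * normal_walk_tail (\sum_(l < m.+1) s l ^+ 2) x.
    rewrite RintegralB// RintegralZl// Rintegral_cst//.
    rewrite (_ : fine (N01 setT) = 1); last first.
      by rewrite -[RHS]/(fine 1%E); congr fine; exact: probability_setT.
    rewrite mulr1; congr (_ - _ * _).
    transitivity (\int[N01]_y fine (N01 [set z | (- x < W (y, z))%R])).
      by apply: eq_Rintegral => y _; rewrite tailE.
    rewrite -WE normal_walk_tailE.
    have V0 : 0 <= \sum_(l < m.+1) s l ^+ 2 by rewrite sumr_ge0// => l _; exact: sqr_ge0.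
    have := gaussian_rv_std (Num.sqrt (\sum_(l < m.+1) s l ^+ 2)).
    by rewrite sqr_sqrtr// => GV; rewrite (gaussian_rv_tail_eq (- x) GV GW).
  rewrite -E1; apply: le_Rintegral => //.
  - rewrite /comp; under eq_fun do rewrite EFinB.
    exact: integrableB.
  - apply: (@bounded_integrable _ _ _ N01 _ 1 msec) => y.
    rewrite ger0_norm ?fine_ge0//; apply: fine_probability_le1.
    have := measurable_xsection y (mwalk s x).
    by congr (measurable _); apply/seteqP; split => z; rewrite /xsection/= inE.
  move=> y _.
  have [xy|xy] := leP (x + s 0%N * y) 0; last first.
    apply: (@le_trans _ _ 0); last by rewrite fine_ge0.
    by have := normal_walk_tail_ge v xy; lra.
  apply: le_trans (Lev (fun l => s l.+1) (x + s 0%N * y)) _.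
  have msec' : measurable [set w | forall i : 'I_m.+1, x + \sum_(l < i.+1) s l * xi' l (y, w) <= 0].
    have := measurable_xsection y (mwalk s x).
    by congr (measurable _); apply/seteqP; split => z; rewrite /xsection/= inE.
  apply: fine_probability_le => //.
    exact: (@measurable_walk_le _ _ m xi (fun l => s l.+1)).
  move=> w /= Hw i; rewrite big_ord_recl/=.
  case: i => -[|i] im /=; first by rewrite big_ord0 addr0.
  by have := Hw (Ordinal (im : (i < m)%N)); rewrite addrA.
- move=> c; rewrite (_ : [set w | _] = [set y : measurableTypeR R | y <= c 0%N] `*`
      [set w | forall l : 'I_m, xi l w <= c l.+1]).
    have my : measurable [set y : measurableTypeR R | y <= c 0%N].
      by apply: (@measurable_set_le R _ (measurableTypeR R) (fun y => y)); exact: measurable_id.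
    have mw : measurable [set w | forall l : 'I_m, xi l w <= c l.+1].
      exact: measurable_forall_le.
    rewrite (_ : fine _ = fine (N01 [set y : measurableTypeR R | (y <= c 0%N)%R] *
      Q [set w | forall l : 'I_m, (xi l w <= c l.+1)%R])%E); last by congr fine; exact: prodP_setX.
    rewrite fineM ?fin_num_measure// (box (fun l => c l.+1)) big_ord_recl.
    by congr (_ * _); rewrite /std_normal_cdf; congr fine; congr normal_prob; apply/seteqP; split => y /=; rewrite in_itv.
  apply/seteqP; split => w /=.
    move=> H; split; first exact: (H ord0).
    by move=> l; exact: (H (lift ord0 l)).
  move=> [H0 H] [[|l] lm]; first exact: H0.
  exact: (H (Ordinal (lm : (l < m)%N))).
Qed.

End independent_normals.

(** * Explicit lower bounds for normal probabilities *)

Section normal_estimates.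
Context (R : realType).

Notation N01 := (normal_prob (0 : R) 1 : probability (measurableTypeR R) R).
Notation peak := (@normal_peak R 1).

Lemma std_normal_pdfE (x : R) : normal_pdf 0 1 x = peak * expR (- (x ^+ 2 / 2)).
Proof.
by rewrite normal_pdfE ?oner_neq0// /normal_fun subr0 expr1n mulNr mulr2n.
Qed.

Lemma std_normal_itv_ge (a b m : R) : a <= b -> 0 <= m ->
  (forall x, a <= x <= b -> m <= normal_pdf 0 1 x) ->
  (b - a) * m <= fine (N01 [set x : measurableTypeR R | a < x <= b]).
Proof.
move=> ab m0 mpdf.
have SE : [set x : measurableTypeR R | a < x <= b] = `]a, b]%classic.
  by apply/seteqP; split => x /=; rewrite in_itv.
rewrite SE -lee_fin fineK; last first.
  by apply: fin_num_measure; exact: measurable_itv.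
rewrite /= /normal_prob.
apply: (@le_trans _ _ (\int[lebesgue_measure]_(x in `]a, b]) m%:E)%E).
  rewrite integral_cst//= lebesgue_measure_itv/= lte_fin.
  case: ltP => [_|ba]; first by rewrite -EFinB -EFinM mulrC.
  by rewrite mule0 lee_fin mulr_le0_ge0// subr_le0.
apply: ge0_le_integral => //.
- by apply/measurable_EFinP; apply: measurable_funTS; exact: measurable_normal_pdf.
- move=> x; rewrite /= in_itv/= => /andP[ax xb].
  by rewrite lee_fin mpdf// xb ltW.
Qed.

Lemma std_normal_peak_sqr_ge : 8^-1 <= peak ^+ 2.
Proof.
have p8 : 0 < pi *+ 2 :> R by rewrite pmulrn_lgt0// pi_gt0.
rewrite /normal_peak expr1n mul1r exprVn sqr_sqrtr ?(ltW p8)//.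
rewrite lef_pV2 ?posrE//.
have := @pihalf_lt2 R; rewrite ltr_pdivrMr// mulr2n.
by move: pi => p; lra.
Qed.

(** 9/8 is the sum of the density losses 5/8 and 1/2. The eighth power of exp(-9/64) >= 55/64
    suffices for 4/15, the value that leads to 1/40. *)
Lemma expR_Nnine_eighths_ge : 4 / 15 <= expR (- (9 / 8)) :> R.
Proof.
have -> : - (9 / 8) = 8%:R * (- (9 / 64)) :> R by field.
rewrite expRM_natl.
apply: (@le_trans _ _ ((1 - 9 / 64) ^+ 8)); last first.
  have p1 : 0 <= 1 - 9 / 64 :> R by lra.
  by rewrite lerXn2r ?nnegrE ?expR_ge0//; exact: expR_ge1Dx.
have p2 : 73 / 100 <= (1 - 9 / 64 : R) ^+ 2 by rewrite expr2; lra.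
have p4 : 53 / 100 <= (1 - 9 / 64 : R) ^+ 4.
  by rewrite (exprM _ 2 2) expr2; move: (_ ^+ 2) p2 => z; nra.
by rewrite (exprM _ 4 2) expr2; move: (_ ^+ 4) p4 => z; nra.
Qed.

(** On the window x^2 <= u^2 + 1 + 1/(4 u^2) <= u^2 + 5/4, whence 5/8. It starts at u + 1/(8u) to
    leave the gap that the Slepian comparison asks for, and its upper end limits a_j X in the other
    coordinates. *)
Lemma std_normal_above_ge (u : R) : 1 <= u ->
  3 / (8 * u) * (peak * expR (- (u ^+ 2 / 2) - 5 / 8)) <=
  fine (N01 [set x : measurableTypeR R | u + (8 * u)^-1 < x <= u + (2 * u)^-1]).
Proof.
move=> u1; have u0 : 0 < u by rewrite (lt_le_trans ltr01).
have -> : 3 / (8 * u) = (u + (2 * u)^-1) - (u + (8 * u)^-1) by field; rewrite gt_eqF.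
apply: std_normal_itv_ge.
- by rewrite lerD2l lef_pV2 ?posrE ?mulr_gt0// ler_pM2r// ler_nat.
- by rewrite mulr_ge0 ?normal_peak_ge0 ?expR_ge0.
- move=> x /andP[ux xu]; rewrite std_normal_pdfE ler_wpM2l ?normal_peak_ge0//.
  rewrite ler_expR -opprD lerN2.
  have x0 : 0 <= x by rewrite (le_trans _ ux)// addr_ge0 ?ltW// invr_gt0 mulr_gt0.
  have : x ^+ 2 <= (u + (2 * u)^-1) ^+ 2 by rewrite lerXn2r ?nnegrE// (le_trans x0).
  have -> : (u + (2 * u)^-1) ^+ 2 = u ^+ 2 + 1 + (u ^+ 2)^-1 / 4.
    by field; rewrite gt_eqF.
  have : (u ^+ 2)^-1 <= 1 by rewrite invf_le1 ?exprn_gt0// exprn_ege1.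
  lra.
Qed.

Lemma normal_walk_tail_le (V W x : R) : 0 <= V -> V <= W -> x <= 0 ->
  normal_walk_tail V x <= normal_walk_tail W x.
Proof.
move=> V0 VW x0; apply: fine_probability_le.
- by apply: measurable_set_lt; apply: measurable_funD => //; exact: measurable_funM.
- by apply: measurable_set_lt; apply: measurable_funD => //; exact: measurable_funM.
move=> y /= H; apply: (lt_le_trans H); rewrite lerD2l.
have Vy : 0 < Num.sqrt V * y by lra.
have y0 : 0 < y.
  rewrite ltNge; apply/negP => y0; move: Vy; rewrite ltNge => /negP; apply.
  by rewrite mulr_ge0_le0.
by rewrite ler_wpM2r ?(ltW y0)// ler_wsqrtr.
Qed.

(** The case r = 0 must be explicit, since division by zero would make the minimum 0 instead of
    1. *)
Definition walk_factor (u r : R) : R :=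
  if r == 0 then 1 else Num.min 1 (Num.sqrt ((1 - r) / (u ^+ 2 * r))).

Lemma walk_factor_ge0 u r : 0 <= walk_factor u r.
Proof. by rewrite /walk_factor; case: ifP => // _; rewrite le_min ler01 sqrtr_ge0. Qed.

(** For r > 0 the right-hand side is P(|N| <= rho) with rho = sqrt((1 - r) / (u^2 r)). On |N| <=
    min(1, rho) the density is at least [peak] times exp(-1/2). For r = 0 the walk does not move and
    the right-hand side is 1. *)
Lemma normal_walk_stay_ge (u r : R) : 1 <= u -> 0 <= r -> r < 1 ->
  walk_factor u r * (2 * peak * expR (- 2^-1)) <=
  1 - 2 * normal_walk_tail (r / (1 - r)) (- u^-1).
Proof.
move=> u1 r0 r1; have u0 : 0 < u by rewrite (lt_le_trans ltr01).
have in1 (q : R) : 0 <= q -> q <= 1 -> q * (2 * peak * expR (- 2^-1)) <=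
    fine (N01 [set x : measurableTypeR R | - q < x <= q]).
  move=> q0 q1; have -> : q * (2 * peak * expR (- 2^-1)) = (q - (- q)) * (peak * expR (- 2^-1)) by ring.
  apply: std_normal_itv_ge.
  - by lra.
  - by rewrite mulr_ge0 ?normal_peak_ge0 ?expR_ge0.
  - move=> x xq; rewrite std_normal_pdfE ler_wpM2l ?normal_peak_ge0//.
    rewrite ler_expR lerN2 -[leRHS]mul1r ler_wpM2r//.
    by rewrite -[x ^+ 2]real_normK ?num_real// exprn_ile1// (le_trans _ q1)// ler_norml.
have mlt (c : R) : measurable [set x : measurableTypeR R | c < x].
  by apply: (@measurable_set_lt R _ (measurableTypeR R) (fun x => x)); exact: measurable_id.
have mle (c : R) : measurable [set x : measurableTypeR R | x <= c].
  by apply: (@measurable_set_le R _ (measurableTypeR R) (fun x => x)); exact: measurable_id.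
have mint (c d : R) : measurable [set x : measurableTypeR R | c < x <= d].
  rewrite (_ : [set x | _] = [set x | c < x] `&` [set x | x <= d]); first exact: measurableI.
  by apply/seteqP; split => x /=; [move/andP|case=> -> ->].
rewrite /walk_factor; case: eqVneq => [->|rn0].
  rewrite mul0r normal_walk_tailE sqrtr0 opprK.
  rewrite (_ : [set y | _] = set0); last first.
    by apply/seteqP; split => y //=; rewrite mul0r ltNge invr_ge0 ltW.
  rewrite measure0 mulr0 subr0; apply: le_trans (in1 _ ler01 (lexx 1)) _.
  exact: fine_probability_le1.
set rho := Num.sqrt ((1 - r) / (u ^+ 2 * r)).
have rp : 0 < r by rewrite lt_neqAle eq_sym rn0.
have rho0 : 0 < rho by rewrite sqrtr_gt0 divr_gt0 ?subr_gt0// mulr_gt0// exprn_gt0.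
set q := Num.min 1 rho.
have q0 : 0 <= q by rewrite le_min ler01 ltW.
have q1 : q <= 1 by rewrite ge_min lexx.
have qr : q <= rho by rewrite ge_min lexx orbT.
apply: le_trans (in1 _ q0 q1) _.
have tailE : normal_walk_tail (r / (1 - r)) (- u^-1) = fine (N01 [set x : measurableTypeR R | rho < x]).
  rewrite normal_walk_tailE opprK; congr (fine (N01 _)).
  have sT : 0 < Num.sqrt (r / (1 - r)) by rewrite sqrtr_gt0 divr_gt0// subr_gt0.
  have -> : rho = u^-1 / Num.sqrt (r / (1 - r)).
    rewrite /rho -[u in RHS](ger0_norm (ltW u0)) -sqrtr_sqr -!sqrtrV ?divr_ge0 ?subr_ge0 ?sqr_ge0 ?(ltW r1)//.
    rewrite -sqrtrM ?invr_ge0 ?sqr_ge0//; congr Num.sqrt.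
    by field; rewrite rn0 !gt_eqF// subr_gt0.
  by apply/seteqP; split => y /=; rewrite ltr_pdivrMr// mulrC.
have symE : fine (N01 [set x : measurableTypeR R | x < - rho]) =
    fine (N01 [set x : measurableTypeR R | rho < x]).
  have := @gaussian_rv_tail_eq R _ _ _ _ N01 N01 _ _ _ rho
    (gaussian_rv_std 1) _.
  have G1 : gaussian_rv N01 (fun y : measurableTypeR R => -1 * y) (1 ^+ 2).
    by have := gaussian_rv_std (-1 : R); rewrite sqrrN.
  move=> /(_ _ G1).
  rewrite (_ : [set w | rho < -1 * w] = [set x : measurableTypeR R | x < - rho]); last first.
    by apply/seteqP; split => y /=; rewrite mulN1r ltrNr.
  by move=> ->; congr (fine (N01 _)); apply/seteqP; split => y /=; rewrite mul1r.
have mlt' (c : R) : measurable [set x : measurableTypeR R | x < c].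
  rewrite (_ : [set x | _] = ~` [set x : measurableTypeR R | c <= x]); last first.
    by apply/seteqP; split => x /=; rewrite ltNge => /negP.
  apply: measurableC.
  rewrite (_ : [set x | _] = [set x : measurableTypeR R | - x <= - c]); last first.
    by apply/seteqP; split => x /=; rewrite lerN2.
  by apply: (@measurable_set_le R _ (measurableTypeR R) (fun x => - x)); exact: measurableT_comp.
set L := [set x : measurableTypeR R | x < - rho] in symE.
set U := [set x : measurableTypeR R | rho < x] in tailE symE.
have mL : measurable L := mlt' (- rho).
have mU : measurable U := mlt rho.
have LU : fine (N01 (~` (L `|` U))) = 1 - 2 * normal_walk_tail (r / (1 - r)) (- u^-1).
  rewrite tailE.
  have dLU : L `&` U = set0.
    apply/seteqP; split => x //= [] /= h1 h2; move: (lt_trans h2 h1) => h3.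
    by have := rho0; lra.
  rewrite probability_setC; last exact: measurableU.
  rewrite measureU// fineB ?fin_num_measure//; last first.
    by rewrite fin_numD !fin_num_measure.
  by rewrite fineD ?fin_num_measure// symE /=; ring.
rewrite -LU; apply: fine_probability_le => //.
  by apply: measurableC; exact: measurableU.
move=> x /= /andP[qx xq] [h|h].
  by have : x < - rho := h; lra.
by have : rho < x := h; lra.
Qed.

End normal_estimates.

(** * The comparison process and the bound for one exceedance *)

Section first_exceedance.
Context (R : realType).

Notation N01 := (normal_prob (0 : R) 1 : probability (measurableTypeR R) R).
Notation peak := (@normal_peak R 1).

Lemma gaussian_family_linear d (T : measurableType d) (P : probability T R) m
    (xi : nat -> T -> R) n (A : 'I_n -> nat -> R) :
  (forall l, measurable_fun setT (xi l)) ->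
  (forall (c : nat -> R) b, \int[P]_w cos (\sum_(l < m) c l * xi l w + b) =
     cos b * expR (- (\sum_(l < m) c l ^+ 2) / 2)) ->
  gaussian_family P (fun i w => \sum_(l < m) A i l * xi l w)
    (fun i j => \sum_(l < m) A i l * A j l).
Proof.
move=> mxi Exi; split => [i|a b].
  by apply: measurable_sum => l; exact: measurable_funM.
have S1 w : \sum_i a i * (\sum_(l < m) A i l * xi l w) =
    \sum_(l < m) (\sum_i a i * A i l) * xi l w.
  under eq_bigr do rewrite mulr_sumr.
  rewrite exchange_big/=; apply: eq_bigr => l _; rewrite mulr_suml.
  by apply: eq_bigr => i _; rewrite mulrA.
have S2 : \sum_i \sum_j a i * a j * (\sum_(l < m) A i l * A j l) =
    \sum_(l < m) (\sum_i a i * A i l) ^+ 2.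
  under eq_bigr do under eq_bigr do rewrite mulr_sumr.
  under eq_bigr do rewrite exchange_big/=.
  rewrite exchange_big/=; apply: eq_bigr => l _.
  rewrite expr2 mulr_suml; apply: eq_bigr => i _; rewrite mulr_sumr.
  by apply: eq_bigr => j _; ring.
under eq_Rintegral do rewrite S1.
by rewrite (Exi (fun l => \sum_i a i * A i l)) S2.
Qed.

Lemma gaussian_family_scaled_std n (al : 'I_n -> R) :
  gaussian_family N01 (fun i (x : measurableTypeR R) => al i * x)
    (fun i j => al i * al j).
Proof.
split => [i|a b]; first exact: measurable_funM.
have [_ E] := gaussian_rv_std (1 : R).
have S2 : \sum_i \sum_j a i * a j * (al i * al j) = (\sum_i a i * al i) ^+ 2.
  rewrite expr2 mulr_suml; apply: eq_bigr => i _; rewrite mulr_sumr.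
  by apply: eq_bigr => j _; ring.
have := E (\sum_i a i * al i) b; rewrite S2 expr1n mulr1 => <-.
apply: eq_Rintegral => x _; rewrite mul1r mulr_suml.
by congr (cos (_ + _)); apply: eq_bigr => i _; rewrite mulrA.
Qed.

(** The argument of Phi with theta = -2 / (u^2 (1 - a)), chosen so that multiplying by sqrt(1 - a)
    gives u (1 - a) - 2/u. *)
Definition shrunk_level (u a : R) : R :=
  u * Num.sqrt (1 - a) * (1 - 2 / (u ^+ 2 * (1 - a))).

Lemma shrunk_levelE (u a : R) : 0 < u -> a < 1 ->
  Num.sqrt (1 - a) * shrunk_level u a = u * (1 - a) - 2 / u.
Proof.
move=> u0 a1; have a0 : 0 < 1 - a by rewrite subr_gt0.
have -> : Num.sqrt (1 - a) * shrunk_level u a =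
    u * Num.sqrt (1 - a) ^+ 2 * (1 - 2 / (u ^+ 2 * (1 - a))).
  by rewrite /shrunk_level; ring.
by rewrite sqr_sqrtr ?ltW//; field; rewrite !gt_eqF.
Qed.

(* Time-changed comparison process: with [B] a Brownian bridge, its value at
   index [i] is [a_i X + B (a_i) + sqrt (1 - a_i) eta_i], and [B] is simulated
   as [(1 - a) W (a / (1 - a))], so that [Cov (Y_i, Y_j) = min a_i a_j]. *)
Lemma bridge_comparison n (a : nat -> R) (r u : R) :
  1 <= u -> 0 <= r -> r < 1 ->
  (forall i, (i < n)%N -> 0 <= a i <= r) ->
  (forall i j, (i <= j)%N -> (j < n)%N -> a i <= a j) ->
  exists (d : measure_display) (S : measurableType d) (Q : probability S R)
    (Y : 'I_n.+1 -> S -> R) (K : 'I_n.+1 -> 'I_n.+1 -> R),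
  [/\ gaussian_family Q Y K,
      forall i, K i i = 1,
      forall i j, K i j = K j i,
      forall i j : 'I_n.+1, (i < j)%N -> K i j = a i &
      expR (- (u ^+ 2 / 2)) / (40 * u) * walk_factor u r *
        \prod_(l < n) std_normal_cdf (shrunk_level u (a l)) <=
      fine (Q [set w | u + (8 * u)^-1 < Y ord_max w /\
                 forall i, i != ord_max -> Y i w < u])].
Proof.
move=> u1 r0 r1 a0r amon; have u0 : 0 < u by rewrite (lt_le_trans ltr01).
have [d [S [Q [xi [mxi Exi walk box]]]]] := independent_normals_walk R n.
(* The value 1 at the last index removes the walk and the noise there, so the last coordinate is X
   itself. *)
pose al (i : nat) : R := if (i < n)%N then a i else 1.
have al1 i : al i <= 1.
  by rewrite /al; case: ifP => // /a0r /andP[_ /le_trans]; apply; exact: ltW.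
have a1 i : (i < n)%N -> a i < 1.
  by move=> /a0r/andP[_ /le_lt_trans]; apply.
(* Brownian times of the bridge. They increase with a, so the increments [sg2] are nonnegative
   variances, and W at time [tau i] is the sum of the first i + 1 steps. *)
pose tau (i : nat) : R := a i / (1 - a i).
have taumon i j : (i <= j)%N -> (j < n)%N -> tau i <= tau j.
  move=> ij jn; have in_ := leq_ltn_trans ij jn.
  rewrite /tau ler_pdivrMr ?subr_gt0 ?a1// mulrAC ler_pdivlMr ?subr_gt0 ?a1//.
  by have := amon _ _ ij jn; lra.
have tau0 i : (i < n)%N -> 0 <= tau i.
  by move=> in_; rewrite divr_ge0 ?subr_ge0 ?(ltW (a1 _ in_))//; case/andP: (a0r _ in_).
pose sg2 (l : nat) : R := if l is l'.+1 then tau l - tau l' else tau 0%N.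
have sg20 l : (l < n)%N -> 0 <= sg2 l.
  by case: l => [|l] ln; [exact: tau0|rewrite subr_ge0 taumon].
have sg2sum i : \sum_(l < i.+1) sg2 l = tau i.
  elim: i => [|i ih]; first by rewrite big_ord1.
  by rewrite big_ord_recr/= ih addrC subrK.
pose sg l := Num.sqrt (sg2 l).
have sgsum i : (i < n)%N -> \sum_(l < i.+1) sg l ^+ 2 = tau i.
  move=> in_; rewrite -sg2sum; apply: eq_bigr => l _.
  by rewrite /sg sqr_sqrtr// sg20// (leq_trans (ltn_ord l)).
(* [w i] builds (1 - a_i) W(tau i), and [v i] picks the single noise term sqrt(1 - a_i) eta_i. The
   two use independent copies of Q. *)
pose w (i : 'I_n.+1) (l : nat) : R := if (l <= i)%N then (1 - al i) * sg l else 0.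
pose v (i : 'I_n.+1) (l : nat) : R := if l == i then Num.sqrt (1 - al i) else 0.
have Gall := gaussian_family_prodD (gaussian_family_scaled_std (fun i : 'I_n.+1 => al i))
  (gaussian_family_prodD (gaussian_family_linear w mxi Exi)
                         (gaussian_family_linear v mxi Exi)).
set KY := (fun i j : 'I_n.+1 => _) in Gall.
set Y := (fun (i : 'I_n.+1) _ => _) in Gall.
have almax (i : 'I_n.+1) : ~~ (i < n)%N -> al i = 1 by rewrite /al => /negbTE ->.
have sumw (i : 'I_n.+1) (F : nat -> R) : (i < n)%N ->
    \sum_(l < n) w i l * F l = (1 - al i) * \sum_(l < i.+1) sg l * F l.
  move=> in_; rewrite (big_ord_widen n (fun l => sg l * F l))//.
  rewrite mulr_sumr [RHS]big_mkcond/=; apply: eq_bigr => l _.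
  by rewrite /w ltnS; case: ifP; rewrite ?mul0r// mulrA.
have sumv (i : 'I_n.+1) (F : nat -> R) (in_ : (i < n)%N) :
    \sum_(l < n) v i l * F l = Num.sqrt (1 - al i) * F i.
  rewrite (bigD1 (Ordinal in_))//= big1 ?addr0; last first.
    move=> l; rewrite -val_eqE/= /v => /negbTE ->; exact: mul0r.
  by rewrite /v eqxx.
have alin (i : 'I_n.+1) : (i < n)%N -> al i = a i by rewrite /al => ->.
have tauE (i : 'I_n.+1) : (i < n)%N -> (1 - al i) * tau i = al i.
  move=> in_; rewrite alin// /tau mulrC divfK// subr_eq0 eq_sym lt_eqF// a1//.
(* The shared steps have variance tau i, and (1 - a_i) tau i = a_i, so a_i a_j + (1 - a_i)(1 - a_j)
   tau i = a_i; the noise terms are independent. *)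
have KYlt (i j : 'I_n.+1) : (i < j)%N -> KY i j = al i.
  move=> ij; have in_ : (i < n)%N by rewrite (leq_trans ij)// -ltnS.
  rewrite /KY sumw// sumv// /v (ltn_eqF ij) mulr0 addr0.
  have -> : \sum_(l < i.+1) sg l * w j l = (1 - al j) * tau i.
    rewrite -sgsum// mulr_sumr; apply: eq_bigr => l _.
    rewrite /w (leq_trans _ (ltnW ij)); last by rewrite -ltnS.
    by rewrite expr2; ring.
  by rewrite mulrCA tauE//; ring.
have KYsym i j : KY i j = KY j i.
  rewrite /KY; congr (_ + (_ + _)); first exact: mulrC.
    by apply: eq_bigr => l _; exact: mulrC.
  by apply: eq_bigr => l _; exact: mulrC.
have KYdiag i : KY i i = 1.
  have [in_|ni] := boolP (i < n)%N.
    have sq : Num.sqrt (1 - al i) * Num.sqrt (1 - al i) = 1 - al i.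
      by rewrite -expr2 sqr_sqrtr ?subr_ge0.
    rewrite /KY sumw// sumv// /v eqxx sq.
    have -> : \sum_(l < i.+1) sg l * w i l = (1 - al i) * tau i.
      rewrite -sgsum// mulr_sumr; apply: eq_bigr => l _.
      by rewrite /w -ltnS ltn_ord expr2; ring.
    by rewrite tauE//; ring.
  rewrite /KY almax// !big1 ?addr0 ?mulr1// => l _.
    by rewrite /v almax// subrr sqrtr0; case: ifP; rewrite mul0r.
  by rewrite /w almax// subrr mul0r; case: ifP; rewrite mul0r.
exists _, _, (prodP N01 (prodP Q Q)), Y, KY; split => //.
  move=> i j ij; rewrite KYlt// alin// (leq_trans ij)// -ltnS//.
set A0 := [set x : measurableTypeR R | u + (8 * u)^-1 < x <= u + (2 * u)^-1].
set A1 := [set p | forall i : 'I_n, - u^-1 + \sum_(l < i.+1) sg l * xi l p <= 0].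
set A2 := [set q | forall l : 'I_n, xi l q <= shrunk_level u (a l)].
have mA0 : measurable A0.
  rewrite (_ : A0 = `]u + (8 * u)^-1, u + (2 * u)^-1]%classic); first exact: measurable_itv.
  by apply/seteqP; split => x /=; rewrite in_itv.
have mA1 : measurable A1 by exact: measurable_walk_le.
have mA2 : measurable A2 by exact: measurable_forall_le.
have prodE : fine (prodP N01 (prodP Q Q) (A0 `*` (A1 `*` A2))) =
    fine (N01 A0) * (fine (Q A1) * fine (Q A2)).
  rewrite -fineM ?fin_num_measure// -fineM; last 2 first.
  - by apply: fin_num_measure.
  - by rewrite fin_numM ?fin_num_measure.
  congr fine; transitivity (N01 A0 * prodP Q Q (A1 `*` A2))%E.
    by apply: prodP_setX => //; exact: measurableX.
  by congr (_ * _)%E; exact: prodP_setX.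
have [mY _] := Gall.
apply: (@le_trans _ _ (fine (prodP N01 (prodP Q Q) (A0 `*` (A1 `*` A2))))); last first.
  apply: fine_probability_le.
  - by apply: measurableX => //; exact: measurableX.
  - apply: (@measurable_last_and_others _ _ R n Y [set x | u + (8 * u)^-1 < x] [set x | x < u]) => //.
      by rewrite -set_itvoy; exact: measurable_itv.
    by rewrite -set_itvNyo; exact: measurable_itv.
  - move=> [x [p q]] /= [/andP[x1 x2] [pA qA]]; split.
      have nn : ~~ ((ord_max : 'I_n.+1) < n)%N by rewrite /= ltnn.
      rewrite /Y/= [X in _ + (X + _)]big1 ?[X in _ + (_ + X)]big1 ?addr0; last 2 first.
      + by move=> l _; rewrite /v (almax ord_max)// subrr sqrtr0; case: ifP; rewrite mul0r.
      + by move=> l _; rewrite /w (almax ord_max)// subrr mul0r; case: ifP; rewrite mul0r.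
      by rewrite (almax ord_max)// mul1r.
    move=> i im; have in_ : (i < n)%N.
      by rewrite ltn_neqAle -ltnS ltn_ord andbT; apply: contra im => /eqP im; apply/eqP/val_inj.
    rewrite /Y/= (sumw i (fun l => xi l p))// (sumv i (fun l => xi l q))//.
    have H1 := pA (Ordinal in_); have H2 := qA (Ordinal in_); rewrite /= in H1 H2.
    have ai1 := a1 _ in_; have /andP[ai0 _] := a0r _ in_.
    rewrite alin//.
    (* The three bounds [H3], [H4], [H5] add up to u - 1/u - a_i / (2u), which is below u. *)
    have H3 : Num.sqrt (1 - a i) * xi i q <= u * (1 - a i) - 2 / u.
      by rewrite -shrunk_levelE// ler_wpM2l ?sqrtr_ge0.
    have H4 : (1 - a i) * \sum_(l < i.+1) sg l * xi l p <= (1 - a i) * u^-1.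
      by rewrite ler_wpM2l ?subr_ge0 ?(ltW ai1)//; lra.
    have H5 : a i * x <= a i * (u + u^-1 / 2).
      by rewrite ler_wpM2l// (le_trans x2)// invfM mulrC.
    have ui : 0 < u^-1 by rewrite invr_gt0.
    have := mulr_ge0 ai0 (ltW ui); lra.
have boxE : fine (Q A2) = \prod_(l < n) std_normal_cdf (shrunk_level u (a l)).
  exact: (box (fun l => shrunk_level u (a l))).
rewrite prodE boxE mulrA; apply: ler_wpM2r.
  by apply: prodr_ge0 => l _; exact: fine_ge0.
have B0 := std_normal_above_ge u1; rewrite -/A0 in B0.
have B1 : walk_factor u r * (2 * peak * expR (- 2^-1)) <= fine (Q A1).
  apply: (le_trans (normal_walk_stay_ge u1 r0 r1)); apply: le_trans (walk sg _).
  rewrite lerD2l lerN2 ler_pM2l//; apply: normal_walk_tail_le.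
  (* The total variance is [tau] at the last index n - 1, hence at most r / (1 - r); for n = 0 there
     are no steps and it is 0. *)
  - by rewrite sumr_ge0// => l _; exact: sqr_ge0.
  - have [n0|n0] := posnP n.
      rewrite big1 ?divr_ge0 ?subr_ge0 ?(ltW r1)// => -[l ln] _.
      by exfalso; move: ln; rewrite n0 ltn0.
    have n1 : (n.-1 < n)%N by rewrite prednK.
    have := sgsum _ n1; rewrite prednK// => ->.
    rewrite /tau ler_pdivrMr ?subr_gt0 ?a1// mulrAC ler_pdivlMr ?subr_gt0//.
    by have /andP[_] := a0r _ n1; lra.
  - by rewrite oppr_le0 invr_ge0 ltW.
apply: le_trans (ler_pM _ _ B0 B1); last 2 first.
- by rewrite mulr_ge0 ?divr_ge0 ?mulr_ge0 ?normal_peak_ge0 ?expR_ge0// ltW.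
- by rewrite !mulr_ge0 ?walk_factor_ge0 ?normal_peak_ge0 ?expR_ge0.
have -> : 3 / (8 * u) * (peak * expR (- (u ^+ 2 / 2) - 5 / 8)) *
    (walk_factor u r * (2 * peak * expR (- 2^-1))) =
    expR (- (u ^+ 2 / 2)) / u * walk_factor u r * (3 / 4 * (peak ^+ 2 * expR (- (9 / 8)))).
  have -> : - (9 / 8) = - (5 / 8) + - 2^-1 :> R by field.
  by rewrite !expRD; field; rewrite gt_eqF.
have -> : expR (- (u ^+ 2 / 2)) / (40 * u) * walk_factor u r =
    expR (- (u ^+ 2 / 2)) / u * walk_factor u r * 40^-1.
  by field; rewrite gt_eqF.
apply: ler_wpM2l.
  by rewrite mulr_ge0 ?walk_factor_ge0// divr_ge0 ?expR_ge0// ltW.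
(* 3/4 times 1/8 times 4/15 equals 1/40. *)
have := @std_normal_peak_sqr_ge R; have := @expR_Nnine_eighths_ge R.
move: (expR _) (peak ^+ 2) => e p e1 p1.
have : 8^-1 * (4 / 15) <= p * e by rewrite ler_pM// invr_ge0.
lra.
Qed.

End first_exceedance.

(** The last column of K agrees with that of the comparison process; elsewhere the comparison
    covariance of i < j is a_i, the smaller of the two values, which K dominates. *)
Lemma gaussian_first_exceedance_ge (R : realType) d (T : measurableType d)
    (P : probability T R) n (X : 'I_n.+1 -> T -> R)
    (K : 'I_n.+1 -> 'I_n.+1 -> R) (a : nat -> R) (r u : R) :
  gaussian_family P X K -> (forall i, K i i = 1) -> (forall i j, K i j = K j i) ->
  (forall i : 'I_n.+1, (i < n)%N -> K i ord_max = a i) ->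
  (forall i j : 'I_n.+1, (i < j)%N -> a i <= K i j) ->
  1 <= u -> 0 <= r -> r < 1 ->
  (forall i, (i < n)%N -> 0 <= a i <= r) ->
  (forall i j, (i <= j)%N -> (j < n)%N -> a i <= a j) ->
  expR (- (u ^+ 2 / 2)) / (40 * u) * walk_factor u r *
    \prod_(l < n) std_normal_cdf (shrunk_level u (a l)) <=
  fine (P [set w | u < X ord_max w /\ forall i, i != ord_max -> X i w <= u]).
Proof.
move=> GX K1 Ksym Kmax Kge u1 r0 r1 a0r amon.
have u0 : 0 < u by rewrite (lt_le_trans ltr01).
have [d' [S [Q [Y [KY [GY KY1 KYsym KYlt bound]]]]]] :=
  bridge_comparison u1 r0 r1 a0r amon.
apply: le_trans bound _.
apply: (slepian_comparison GX GY); last by rewrite ltrDl invr_gt0 mulr_gt0.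
  by move=> i; rewrite K1 KY1.
have lt_case (i j : 'I_n.+1) : (i < j)%N -> K i j = KY i j \/
    [/\ i != ord_max, j != ord_max & KY i j <= K i j].
  move=> ij; have in_ : (i < n)%N by rewrite (leq_trans ij)// -ltnS.
  have im : i != ord_max by rewrite -val_eqE/= ltn_eqF.
  have [->|jm] := eqVneq j ord_max; first by left; rewrite Kmax// KYlt.
  by right; split => //; rewrite KYlt// Kge.
move=> i j ij; case: (ltngtP i j) => [/lt_case//|/lt_case|/val_inj ijE].
  by rewrite Ksym KYsym => -[->|[]]; [left|right; split].
by rewrite ijE eqxx in ij.
Qed.

(** * Summation over first exceedances *)

Lemma std_normal_cdf01 (R : realType) (x : R) : 0 <= std_normal_cdf x <= 1.
Proof.
rewrite /std_normal_cdf; apply/andP; split; first exact/fine_ge0/measure_ge0.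
apply: (@fine_probability_le1 R _ (measurableTypeR R) (normal_prob 0 1)).
exact: measurable_itv.
Qed.

Theorem theorem1 (R : realType) :
  exists C : R, 0 < C /\
  forall (n : nat) (hn : (2 <= n)%N)
    (d : measure_display) (T : measurableType d) (P : probability T R)
    (Z : 'I_n -> {RV P >-> R}) (r : nat -> R) (u : R),
    jointly_normal Z ->
    (forall i, 'E_P[Z i] = 0)%E ->
    (forall i, 'E_P[fun w => (Z i w ^+ 2)%R] = 1)%E ->
    (forall j k, j != k -> (`| 'E_P[fun w => (Z j w * Z k w)%R] | < 1)%E) ->
    (forall j k, 'E_P[fun w => (Z j w * Z k w)%R] = (r `|j - k|%N)%:E)%E ->
    1 <= u ->
    (forall l m : nat, (l <= m)%N -> (m < n)%N -> r m <= r l) ->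
    (forall m : nat, (m < n)%N -> 0 <= r m) ->
    r 1%N * (1 + 2 * u ^- 2) <= 1 ->
    exists theta : nat -> R,
      (forall j : nat, (1 <= j < n)%N ->
         `|theta j| <= C / (u ^+ 2 * (1 - r j))) /\
      (P [set w | (u%:E < \big[maxe/-oo]_(i < n) (Z i w)%:E)%E] >=
       (n%:R * (expR (- (u ^+ 2 / 2)) / (40 * u)) *
        (if r 1%N == 0 then 1
         else Num.min 1 (Num.sqrt ((1 - r 1%N) / (u ^+ 2 * r 1%N)))) *
        \prod_(1 <= j < n)
          std_normal_cdf (u * Num.sqrt (1 - r j) * (1 + theta j)))%:E)%E.
Proof.
(* The witness theta_j is exactly -2 / (u^2 (1 - r(j))), so C = 2. *)
exists 2; split => // n hn d T P Z r u jn EZ EZ2 Elt1 EZZ u1 rmon r0 _.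
have u0 : 0 < u by rewrite (lt_le_trans ltr01).
have n0 : (0 < n)%N by rewrite (leq_trans _ hn).
have r1 : r 1%N < 1.
  have := Elt1 (Ordinal n0) (Ordinal hn) isT.
  rewrite EZZ /= lte_fin; apply: le_lt_trans; exact: ler_norm.
have rj1 j : (1 <= j < n)%N -> r j < 1.
  by move=> /andP[j1 jn1]; apply: le_lt_trans r1; exact: rmon.
have r00 : r 0%N = 1.
  have := EZZ (Ordinal n0) (Ordinal n0); rewrite distnn => /esym.
  have := EZ2 (Ordinal n0).
  rewrite (_ : (fun w => Z _ w ^+ 2) = (fun w => Z (Ordinal n0) w * Z (Ordinal n0) w)).
    by move=> -> [].
  by apply/funext => w; rewrite expr2.
exists (fun j => - (2 / (u ^+ 2 * (1 - r j)))); split.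
  move=> j j1n; rewrite normrN ger0_norm// divr_ge0// mulr_ge0 ?sqr_ge0//.
  by rewrite subr_ge0 ltW// rj1.
have GZ := jointly_normal_gaussian_family jn EZ EZZ.
pose F j := std_normal_cdf (shrunk_level u (r j)).
rewrite -/(walk_factor u (r 1%N)).
pose E (m : 'I_n) := [set w | u < Z m w /\ forall i : 'I_n, (i < m)%N -> Z i w <= u].
have mE m : measurable (E m).
  rewrite (_ : E m = [set w | u < Z m w] `&`
      \bigcap_(i in [set i : 'I_n | (i < m)%N]) [set w | Z i w <= u]).
    apply: measurableI; first exact: measurable_set_lt.
    by apply: fin_bigcap_measurable => // i _; exact: measurable_set_le.
  by apply/seteqP; split => w /=.
have EP (m : 'I_n) : expR (- (u ^+ 2 / 2)) / (40 * u) * walk_factor u (r 1%N) *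
    \prod_(1 <= j < n) F j <= fine (P (E m)).
  have mn : (m.+1 <= n)%N by [].
  pose g (i : 'I_m.+1) := widen_ord mn i.
  have GX := gaussian_family_reindex g GZ.
  have rE (i j : 'I_m.+1) : (i < j)%N -> r `|g i - g j|%N = r (j - i)%N.
    by move=> ij; rewrite /= distnEr// ltnW.
  have mn' k : (k <= m)%N -> (k < n)%N by move=> km; rewrite (leq_ltn_trans km).
  (* Only the lags 1, ..., m occur up to index m. The factors for larger lags are at most 1, so the
     full product is smaller and one bound serves every m. The lag m - l reflects a_l = r(m - l). *)
  apply: (@le_trans _ _ (expR (- (u ^+ 2 / 2)) / (40 * u) * walk_factor u (r 1%N) *
      \prod_(l < m) F (m - l)%N)).
    apply: ler_wpM2l.
      by rewrite mulr_ge0 ?walk_factor_ge0// divr_ge0 ?expR_ge0// mulr_ge0// ltW.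
    have F01 j : 0 <= F j <= 1 := std_normal_cdf01 _.
    have -> : \prod_(l < m) F (m - l)%N = \prod_(1 <= j < m.+1) F j.
      rewrite big_add1 big_mkord (reindex_inj rev_ord_inj)/=.
      by apply: eq_bigr => l _; rewrite subKn.
    rewrite (big_cat_nat (n := m.+1))//= ler_piMr//.
      by apply: prodr_ge0 => j _; have /andP[] := F01 j.
    by apply: prodr_ile1 => j _; exact: F01.
  apply: le_trans (@gaussian_first_exceedance_ge R _ T P m _ _ (fun i => r (m - i)%N) (r 1%N) u
    GX _ _ _ _ u1 _ r1 _ _) _.
  - by move=> i; rewrite distnn.
  - by move=> i j; rewrite distnC.
  - by move=> i im; rewrite rE.
  (* As j <= m, the lag j - i is at most m - i, so r(j - i) >= r(m - i) = a_i. *)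
  - move=> i j ij; rewrite rE//; apply: rmon.
      by rewrite leq_sub2r// -ltnS.
    by rewrite mn'// leq_subr.
  - exact: r0.
  - move=> i im; rewrite r0 ?mn' ?leq_subr//=; apply: rmon; first by rewrite subn_gt0.
    by rewrite mn'// leq_subr.
  - move=> i j ij jm; apply: rmon; first by rewrite leq_sub2l.
    by rewrite mn'// leq_subr.
  have mcdf (c : R) : measurable [set x : R | x <= c].
    by rewrite -set_itvNyc; exact: measurable_itv.
  apply: fine_probability_le => //.
    apply: (@measurable_last_and_others _ _ R m (fun i => Z (g i) : T -> R) [set x | u < x] [set x | x <= u]) => //.
    by rewrite -set_itvoy; exact: measurable_itv.
  move=> w [uZ Zu]; split.
    by rewrite (_ : m = g ord_max)//; exact: val_inj.
  move=> i im; have im' : (i < m.+1)%N by rewrite ltnW.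
  rewrite (_ : i = g (Ordinal im')); last exact: val_inj.
  by apply: Zu; rewrite -val_eqE/= ltn_eqF.
pose A := [set w | (u%:E < \big[maxe/-oo]_(i < n) (Z i w)%:E)%E].
have AE w : A w <-> exists i, u < Z i w.
  split.
    move=> /bigmax_gtP[|[i _ ui]]; first by rewrite ltNge leNye.
    by exists i; rewrite -lte_fin.
  by move=> [i ui]; apply/bigmax_gtP; right; exists i.
have mA : measurable A.
  rewrite (_ : A = \bigcup_(i in [set: 'I_n]) [set w | u < Z i w]).
    by apply: fin_bigcup_measurable => // i _; exact: measurable_set_lt.
  apply/seteqP; split => w; first by move=> /AE[i ui]; exists i.
  by move=> [i _ ui]; apply/AE; exists i.
have tE : trivIset setT E.
  apply/trivIsetP => i j _ _ ij; apply/seteqP; split => w //= [[ui Ei] [uj Ej]].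
  case: (ltngtP i j) => [ltij|ltji|/val_inj eij].
  - by have := Ej i ltij; rewrite leNgt ui.
  - by have := Ei j ltji; rewrite leNgt uj.
  - by rewrite eij eqxx in ij.
have UE : (P (\big[setU/set0]_(m < n) E m) <= P A)%E.
  apply: le_measure; rewrite ?inE//; first exact: bigsetU_measurable.
  elim/big_ind : _ => [//|U V UA VA w [/UA//|/VA//]|m _ w [um _]].
  by apply/AE; exists m.
apply: le_trans UE; rewrite measure_bigsetU_ord//.
have -> : (\sum_(m < n) P (E m) = (\sum_(m < n) fine (P (E m)))%:E)%E.
  by rewrite -sumEFin; apply: eq_bigr => m _; rewrite fineK// fin_num_measure.
rewrite lee_fin.
apply: (@le_trans _ _ (\sum_(m < n) (expR (- (u ^+ 2 / 2)) / (40 * u) *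
    walk_factor u (r 1%N) * \prod_(1 <= j < n) F j))); last exact: ler_sum.
rewrite sumr_const card_ord -[leRHS]mulr_natl.
have -> : \prod_(1 <= j < n) std_normal_cdf (u * Num.sqrt (1 - r j) *
    (1 + - (2 / (u ^+ 2 * (1 - r j))))) = \prod_(1 <= j < n) F j by [].
by rewrite !mulrA.
Qed.
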